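(* Let $m\in\mathbb{N}$. For any centered Gaussian random vector $(X_1,X_2,X_3)$ (each $X_i$ real-valued with positive variance), $$E[X_1^{2m}X_2^{6}X_3^{4}]\ge E[X_1^{2m}]\,E[X_2^{6}]\,E[X_3^{4}],$$ and equality holds if and only if $X_1,X_2,X_3$ are independent.
   Context: All Gaussian random variables are assumed real-valued and non-degenerate (positive variance). $\mathbb{N}=\{1,2,3,\dots\}$. *)

(* Defs.v *)
From HB Require Import structures.
From mathcomp Require Import all_boot all_order all_algebra.
From mathcomp Require Import all_classical all_reals all_analysis.
Set Implicit Arguments. Unset Strict Implicit. Unset Printing Implicit Defensive.
Import Order.TTheory GRing.Theory Num.Theory.
Local Open Scope classical_set_scope.
Local Open Scope ring_scope.

(* A real random variable Y on (T, P) is centered normal N(0, s^2) with s > 0: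
   its law is the Gaussian law with density normal_pdf 0 s
   (mathcomp-analysis' normal_prob, parameterized by the standard deviation). *)
Definition centered_normal_law d (T : measurableType d) (R : realType)
  (P : probability T R) (Y : T -> R) (s : R) : Prop :=
  0 < s /\ forall A : set R, measurable A -> P (Y @^-1` A) = normal_prob 0 s A.

Definition centered_gaussian d (T : measurableType d) (R : realType)
  (P : probability T R) (Y : T -> R) : Prop :=
  P [set w | Y w = 0] = 1%E \/ exists s : R, centered_normal_law P Y s.

Definition centered_gaussian_vector3 d (T : measurableType d) (R : realType)
  (P : probability T R) (X1 X2 X3 : T -> R) : Prop :=
  forall a1 a2 a3 : R,
    centered_gaussian P (fun w => a1 * X1 w + a2 * X2 w + a3 * X3 w).

Definition independent3 d (T : measurableType d) (R : realType)
  (P : probability T R) (X1 X2 X3 : T -> R) : Prop :=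
  forall A1 A2 A3 : set R, measurable A1 -> measurable A2 -> measurable A3 ->
    P (X1 @^-1` A1 `&` X2 @^-1` A2 `&` X3 @^-1` A3) =
    (P (X1 @^-1` A1) * P (X2 @^-1` A2) * P (X3 @^-1` A3))%E.

(* Main.v *)
(* By Gram-Schmidt, X1 = s X, X2 = x X + u G, X3 = y X + v G + w H with X, G, H
   independent standard normal, so E[X1^(2m) X2^6 X3^4] / E[X1^(2m)] equals
   T64 + 6 w^2 T62 + 3 w^4 T60, where T(i)(j) = E[(x X + u G)^i (y X + v G)^j] with X
   biased by X^(2m). It suffices to bound T64, T62 and T60, i.e. to treat singular
   covariances. Replacing (y X + v G)^2 by an arbitrary quadratic form q, the bound
   on T64 becomes positivity of the quadratic form
   E[(x X + u G)^6 q^2] - 46 (x^2 + u^2)^3 (tr q)^2 in q, whose minors are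
   polynomials in x^2, u^2 and m - 1 with almost only nonnegative coefficients.
   As 46 > 45, equality forces y = v = 0 and then x = 0: the variables are
   uncorrelated, and their cosine transform factors, which gives independence. *)

Require Import Defs.
From HB Require Import structures.
From mathcomp Require Import all_boot all_order all_algebra.
From mathcomp Require Import all_classical all_reals all_analysis.
From mathcomp Require Import measurable_realfun.
From mathcomp Require Import ring lra.
Set Implicit Arguments. Unset Strict Implicit. Unset Printing Implicit Defensive.
Import Order.TTheory GRing.Theory Num.Theory.
Import numFieldNormedType.Exports.
Local Open Scope classical_set_scope.
Local Open Scope ring_scope.

(** * The moment form *)

(** The constants fit because [15 * 3 = 45]: the bounds with [46], [15] and [15], taken with the
    weights [1], [6 w^2] and [3 w^4], add up to [45 (y^2 + v^2 + w^2)^2] plus a surplus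
    [(y^2 + v^2)^2], all times [(x^2 + u^2)^3]. Nonnegativity of a quartic in [y, v] is not decided
    by minors; for [q = a X^2 + b X G + c G^2] the same bound concerns a 3 by 3 Hankel matrix minus
    a rank-one matrix, where minors do decide. The analytic obstacle is that the hypothesis only
    gives the laws of linear combinations, and that the joint law may be singular, without a
    density. All joint information is therefore extracted from one-dimensional moment generating
    functions: mixed moments by comparing coefficients of polynomials in the weights of the
    combination, and independence from integrals of cosines. *)

Section moment_form.
Variable R : realFieldType.
Implicit Types S U n : R.
(* [E[X^(2 m) X^(2 k)] / E[X^(2 m)]] for standard normal [X] and [m = n + 1]. *)
Definition biased_moment n (k : nat) : R := \prod_(i < k) (n *+ 2 + (2 * i + 3)%:R).

(* [coef64_i] is [E[(x X + u G)^6 X^i G^(4 - i)]], divided by [x u] for odd [i],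
   with [X] biased by [X^(2 n + 2)], [G] standard normal, [S = x^2], [U = u^2];
   likewise [coef62_i] below, with [2 - i] in place of [4 - i]. *)
Definition coef64_0 S U n :=
  945 * U ^+ 3 + 15 * 105 * biased_moment n 1 * S * U ^+ 2
  + 15 * 15 * biased_moment n 2 * S ^+ 2 * U + 3 * biased_moment n 3 * S ^+ 3.
Definition coef64_1 S U n :=
  6 * 105 * biased_moment n 1 * U ^+ 2 + 20 * 15 * biased_moment n 2 * S * U
  + 6 * 3 * biased_moment n 3 * S ^+ 2.
Definition coef64_2 S U n :=
  105 * biased_moment n 1 * U ^+ 3 + 15 * 15 * biased_moment n 2 * S * U ^+ 2
  + 15 * 3 * biased_moment n 3 * S ^+ 2 * U + biased_moment n 4 * S ^+ 3.
Definition coef64_3 S U n :=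
  6 * 15 * biased_moment n 2 * U ^+ 2 + 20 * 3 * biased_moment n 3 * S * U
  + 6 * biased_moment n 4 * S ^+ 2.
Definition coef64_4 S U n :=
  15 * biased_moment n 2 * U ^+ 3 + 15 * 3 * biased_moment n 3 * S * U ^+ 2
  + 15 * biased_moment n 4 * S ^+ 2 * U + biased_moment n 5 * S ^+ 3.

Lemma biased_momentE n : (biased_moment n 1 = 2*n+3)
  * (biased_moment n 2 = (2*n+3)*(2*n+5)) * (biased_moment n 3 = (2*n+3)*(2*n+5)*(2*n+7))
 * (biased_moment n 4 = (2*n+3)*(2*n+5)*(2*n+7)*(2*n+9))
   * (biased_moment n 5 = (2*n+3)*(2*n+5)*(2*n+7)*(2*n+9)*(2*n+11)).
Proof. rewrite /biased_moment !big_ord_recr !big_ord0 /=; do ! split; ring. Qed.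

(* Once expanded, the inequalities below are linear in the monomials
   [S^i U^j n^k], and [lra] only needs to know that these are nonnegative. *)
Ltac add_monomials d mon t :=
  let rec go i :=
    let j := eval compute in (d - i)%N in
    move: (mon i j 0%N) (mon i j 1%N) (mon i j 2%N) (mon i j 3%N) (mon i j 4%N)
      (mon i j 5%N) (mon i j 6%N) (mon i j 7%N) (mon i j 8%N) (mon i j 9%N)
      (mon i j 10%N) (mon i j 11%N) (mon i j 12%N);
    lazymatch i with 0%N => idtac | S ?i' => go i' end in
  go t.

Lemma mono_ge0 S U n : 0 <= S -> 0 <= U -> 0 <= n ->
  forall i j k, 0 <= S ^+ i * U ^+ j * n ^+ k.
Proof. by move=> *; rewrite !mulr_ge0 ?exprn_ge0. Qed.

(** The minor on the rows of [X^2] and [X G] in the matrix of the form minus [46 (S + U)^3] times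
    the squared trace. The term [S ^+ 6 + U ^+ 6] is a margin that makes this minor strictly
    positive, as the completion of squares requires. *)
Lemma coef64_minor S U n : 0 <= S -> 0 <= U -> 0 <= n ->
  S * U * coef64_3 S U n ^+ 2 + 46
    * (S + U) ^+ 3 * coef64_2 S U n
      + (S ^+ 6 + U ^+ 6) <= coef64_4 S U n * coef64_2 S U n.
Proof.
move=> S0 U0 n0.
have mon := mono_ge0 S0 U0 n0.
rewrite /coef64_4 /coef64_3 /coef64_2 !biased_momentE.
add_monomials 6%N mon 6%N.
lra.
Qed.

(** The determinant of that matrix, in the form [det H - k t^T adj(H) t] of the determinant of
    [H - k t t^T], where [t = (1, 0, 1)] is the trace functional. The factors [x u] of the odd
    entries only occur in pairs, hence [S * U]. *)
Lemma coef64_det_ge0 S U n : 0 <= S -> 0 <= U -> 0 <= n ->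
  0 <= coef64_4 S U n * (coef64_0 S U n * coef64_2 S U n - S * U * coef64_1 S U n ^+ 2)
     - S * U * coef64_3 S U n * (coef64_3 S U n * coef64_0 S U n
       - coef64_1 S U n * coef64_2 S U n)
     + coef64_2 S U n * (S * U * coef64_3 S U n * coef64_1 S U n - coef64_2 S U n ^+ 2)
   - 46 * (S + U) ^+ 3 * ((coef64_4 S U n * coef64_2 S U n
     - S * U * coef64_3 S U n ^+ 2)
       + (coef64_0 S U n * coef64_2 S U n - S * U * coef64_1 S U n ^+ 2)
       - 2 * (coef64_2 S U n ^+ 2 - S * U * coef64_3 S U n * coef64_1 S U n)).
Proof.
move=> S0 U0 n0.
have mon := mono_ge0 S0 U0 n0.
(* The four negative coefficients are absorbed by these squares. *)
have sq i j k : 0 <= S ^+ i * U ^+ j * n ^+ k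
  * (U ^+ 2 - S ^+ 2 * n ^+ 2) ^+ 2 by rewrite mulr_ge0 ?sqr_ge0 ?mon.
rewrite /coef64_4 /coef64_3 /coef64_2 /coef64_1 /coef64_0 !biased_momentE.
move: (sq 1 4 2)%N (sq 1 4 3)%N (sq 1 4 4)%N (sq 0 5 3)%N.
add_monomials 9%N mon 9%N.
lra.
Qed.

Definition coef62_0 S U n :=
  105 * U ^+ 3 + 15 * 15 * biased_moment n 1 * S * U ^+ 2
  + 15 * 3 * biased_moment n 2 * S ^+ 2 * U + biased_moment n 3 * S ^+ 3.
Definition coef62_1 S U n :=
  6 * 15 * biased_moment n 1 * U ^+ 2 + 20 * 3 * biased_moment n 2 * S * U
  + 6 * biased_moment n 3 * S ^+ 2.
Definition coef62_2 S U n :=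
  15 * biased_moment n 1 * U ^+ 3 + 15 * 3 * biased_moment n 2 * S * U ^+ 2
  + 15 * biased_moment n 3 * S ^+ 2 * U + biased_moment n 4 * S ^+ 3.
Definition moment60 S U n :=
  15 * U ^+ 3 + 15 * 3 * biased_moment n 1 * S * U ^+ 2
  + 15 * biased_moment n 2 * S ^+ 2 * U + biased_moment n 3 * S ^+ 3.

Lemma coef62_det_ge0 S U n : 0 <= S -> 0 <= U -> 0 <= n ->
  S * U * coef62_1 S U n ^+ 2 <= (coef62_2 S U n - 15 * (S + U) ^+ 3)
    * (coef62_0 S U n - 15 * (S + U) ^+ 3).
Proof.
move=> S0 U0 n0.
have mon := mono_ge0 S0 U0 n0.
(* This square absorbs the one negative coefficient, that of [S U^5 n^2]. *)
have sq : 0 <= S ^+ 0 * U ^+ 4 * n ^+ 1 * (U - S * n) ^+ 2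
  by rewrite mulr_ge0 ?sqr_ge0 ?mon.
rewrite /coef62_2 /coef62_1 /coef62_0 !biased_momentE.
add_monomials 6%N mon 6%N.
lra.
Qed.

Lemma coef62_minor S U n : 0 <= S -> 0 <= U -> 0 <= n ->
  S ^+ 3 + U ^+ 3 <= (coef62_2 S U n - 15 * (S + U) ^+ 3).
Proof.
move=> S0 U0 n0.
have mon := mono_ge0 S0 U0 n0.
rewrite /coef62_2 /coef62_1 /coef62_0 !biased_momentE.
add_monomials 3%N mon 3%N.
lra.
Qed.

Lemma binary_quadratic_ge0 (a b d : R) y z : 0 < a -> b ^+ 2 <= a * d ->
  0 <= a * y ^+ 2 + 2 * b * y * z + d * z ^+ 2.
Proof.
move=> a0 bad; rewrite -(pmulr_rge0 _ a0).
have -> : a * (a * y ^+ 2 + 2 * b * y * z + d * z ^+ 2) = (a * y + b * z) ^+ 2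
  + (a * d - b ^+ 2) * z ^+ 2 by ring.
by rewrite addr_ge0 ?sqr_ge0 // mulr_ge0 ?sqr_ge0 // subr_ge0.
Qed.

(** The trace [a + c] does not involve [b], so the square in [b] is completed first, with pivot [s2]
    free of [k]. What remains is a binary form in [a, c] whose determinant is [s2] times the 3 by 3
    determinant. *)
Lemma hankel3_psd (s4 s3 s2 s1 s0 k : R) a b c : 0 < s2 ->
  0 < s4 * s2 - s3 ^+ 2 - k * s2 ->
  0 <= s4 * (s0 * s2 - s1 ^+ 2) - s3 * (s3 * s0 - s1 * s2) + s2 * (s3 * s1 - s2 ^+ 2)
     - k * ((s4 * s2 - s3 ^+ 2) + (s0 * s2 - s1 ^+ 2) - 2 * (s2 ^+ 2 - s3 * s1)) ->
  k * (a + c) ^+ 2 <= s4 * a ^+ 2 + 2 * s3 * a * b + s2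
    * (2 * a * c + b ^+ 2) + 2 * s1 * b * c + s0 * c ^+ 2.
Proof.
move=> s2_gt0 m1 m2; rewrite -subr_ge0 -(pmulr_rge0 _ s2_gt0).
have := binary_quadratic_ge0 (b := s2 ^+ 2 - s3 * s1 - k * s2) (d := s0 * s2 - s1 ^+ 2
  - k * s2) a c m1.
have /[swap] /[apply] : (s2 ^+ 2 - s3 * s1 - k * s2) ^+ 2 <=
   (s4 * s2 - s3 ^+ 2 - k * s2) * (s0 * s2 - s1 ^+ 2 - k * s2).
  by rewrite -subr_ge0; have := mulr_ge0 (ltW s2_gt0) m2; congr (0 <= _); ring.
move=> H; have := addr_ge0 H (sqr_ge0 (s2 * b + s3 * a + s1 * c)).
by congr (0 <= _); ring.
Qed.

Definition moment64 x u y v n := let S := x ^+ 2 in let U := u ^+ 2 in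
  coef64_4 S U n * y ^+ 4 + 4 * (x * u * coef64_3 S U n) * y ^+ 3 * v
    + 6 * coef64_2 S U n * y ^+ 2 * v ^+ 2
  + 4 * (x * u * coef64_1 S U n) * y * v ^+ 3 + coef64_0 S U n * v ^+ 4.
Definition moment62 x u y v n := let S := x ^+ 2 in let U := u ^+ 2 in
  coef62_2 S U n * y ^+ 2 + 2 * (x * u * coef62_1 S U n) * y * v
    + coef62_0 S U n * v ^+ 2.

Lemma addr_exp_gt0 S U k : 0 <= S -> 0 <= U -> 0 < S + U -> 0 < S ^+ k + U ^+ k.
Proof.
move=> S0 U0 SU0; have Sk : 0 <= S ^+ k by exact: exprn_ge0.
have Uk : 0 <= U ^+ k by exact: exprn_ge0.
rewrite lt_neqAle addr_ge0// andbT eq_sym paddr_eq0// negb_and !expf_eq0.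
by move: SU0; have [->|?] := eqVneq S 0; have [->|?] := eqVneq U 0;
  rewrite ?addr0 ?ltxx ?andbF ?orbT.
Qed.

(* Bounding by 46 instead of 45 is possible as [2 m >= 2], and makes the
   inequality strict. Positivity holds for all quadratic forms [q(X, G)] in
   place of the square [(y X + v G)^2]. *)
Lemma moment64_ge x u y v n : 0 <= n -> 0 < x ^+ 2 + u ^+ 2 ->
  46 * (x ^+ 2 + u ^+ 2) ^+ 3 * (y ^+ 2 + v ^+ 2) ^+ 2 <= moment64 x u y v n.
Proof.
move=> n0 xu0; rewrite /moment64 /=.
set S := x ^+ 2; set U := u ^+ 2.
have S0 : 0 <= S by exact: sqr_ge0.
have U0 : 0 <= U by exact: sqr_ge0.
have SU3 k : 0 < S ^+ k + U ^+ k by exact: addr_exp_gt0.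
have h2p : 0 < coef64_2 S U n.
  apply: (lt_le_trans (SU3 3)).
  have mon := mono_ge0 S0 U0 n0.
  rewrite /coef64_2 !biased_momentE; add_monomials 3%N mon 3%N; lra.
have m1 := coef64_minor S0 U0 n0; have m2 := coef64_det_ge0 S0 U0 n0.
have Exu : (x * u) ^+ 2 = S * U by rewrite exprMn.
(* The square [(y X + v G)^2] has coordinates [a = y^2], [b = 2 y v], [c = v^2]; then
   [6 y^2 v^2 = 2 a c + b^2]. *)
apply: (@le_trans _ _ (coef64_4 S U n * (y ^+ 2) ^+ 2 + 2
  * (x * u * coef64_3 S U n) * y ^+ 2 * (2 * y * v)
   + coef64_2 S U n * (2 * y ^+ 2 * v ^+ 2 + (2 * y * v) ^+ 2)
   + 2 * (x * u * coef64_1 S U n) * (2 * y * v) * v ^+ 2 + coef64_0 S U n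
     * (v ^+ 2) ^+ 2)); last first.
  by rewrite le_eqVlt; apply/orP; left; apply/eqP; ring.
apply: hankel3_psd => //.
- rewrite exprMn Exu; have := SU3 6%N; move: m1; lra.
- by move: m2; rewrite -Exu; congr (0 <= _); ring.
Qed.

Lemma moment62_ge x u y v n : 0 <= n -> 0 < x ^+ 2 + u ^+ 2 ->
  15 * (x ^+ 2 + u ^+ 2) ^+ 3 * (y ^+ 2 + v ^+ 2) <= moment62 x u y v n.
Proof.
move=> n0 xu0; rewrite /moment62 /=.
set S := x ^+ 2; set U := u ^+ 2.
have S0 : 0 <= S by exact: sqr_ge0.
have U0 : 0 <= U by exact: sqr_ge0.
have SU3 k : 0 < S ^+ k + U ^+ k by exact: addr_exp_gt0.
have m1 := lt_le_trans (SU3 3) (coef62_minor S0 U0 n0);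
  have m2 := coef62_det_ge0 S0 U0 n0.
have := binary_quadratic_ge0 (b := x * u * coef62_1 S U n) (d := coef62_0 S U n - 15
  * (S + U) ^+ 3) y v m1.
rewrite exprMn exprMn => /(_ m2); rewrite -subr_ge0 => H; rewrite -subr_ge0.
by move: H; rewrite subr0; congr (0 <= _); ring.
Qed.

(** The bias raises the even moments [1, 3, 15] of [X] to at least [3, 15, 105]. Part of the gain is
    kept on the left, since it forces [x = 0] in the equality case. *)
Lemma moment60_ge x u n : 0 <= n ->
  90 * x ^+ 2 * (x ^+ 4 + u ^+ 4) <= moment60 (x ^+ 2) (u ^+ 2) n - 15
    * (x ^+ 2 + u ^+ 2) ^+ 3.
Proof.
move=> n0.
have mon := mono_ge0 (sqr_ge0 x) (sqr_ge0 u) n0.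
rewrite /moment60 !biased_momentE; add_monomials 3%N mon 3%N; lra.
Qed.

Definition moment_form x u y v w n :=
  moment64 x u y v n + 6 * w ^+ 2 * moment62 x u y v n
  + 3 * w ^+ 4 * moment60 (x ^+ 2) (u ^+ 2) n.

Lemma moment_form_ge x u y v w n : 0 <= n -> 0 < x ^+ 2 + u ^+ 2 ->
  45 * (x ^+ 2 + u ^+ 2) ^+ 3 * (y ^+ 2 + v ^+ 2 + w ^+ 2) ^+ 2
  + (x ^+ 2 + u ^+ 2) ^+ 3 * (y ^+ 2 + v ^+ 2) ^+ 2 + 270 * w ^+ 4 * x ^+ 2
    * (x ^+ 4 + u ^+ 4)
  <= moment_form x u y v w n.
Proof.
move=> n0 xu0; rewrite /moment_form.
have A := moment64_ge y v n0 xu0.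
have w2 : 0 <= 6 * w ^+ 2 by rewrite mulr_ge0 ?sqr_ge0.
have B := ler_wpM2l w2 (moment62_ge y v n0 xu0).
have w4 : 0 <= 3 * w ^+ 4 by rewrite mulr_ge0 // (exprM _ 2 2) sqr_ge0.
have C := ler_wpM2l w4 (moment60_ge x u n0).
move: A B C; lra.
Qed.

Lemma moment_form_eq x u y v w n : 0 <= n -> 0 < x ^+ 2 + u ^+ 2 ->
  0 < y ^+ 2 + v ^+ 2 + w ^+ 2 ->
  moment_form x u y v w n = 45 * (x ^+ 2 + u ^+ 2) ^+ 3
    * (y ^+ 2 + v ^+ 2 + w ^+ 2) ^+ 2 ->
  [/\ x = 0, y = 0 & v = 0].
Proof.
move=> n0 xu0 q0 E; have := moment_form_ge y v w n0 xu0.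
rewrite {}E -addrA gerDl => le0.
have p3 : 0 < (x ^+ 2 + u ^+ 2) ^+ 3 by rewrite exprn_gt0.
have e4 (t : R) : 0 <= t ^+ 4 by rewrite (exprM _ 2 2) sqr_ge0.
have A0 : 0 <= (x ^+ 2 + u ^+ 2) ^+ 3
  * (y ^+ 2 + v ^+ 2) ^+ 2 by rewrite mulr_ge0 ?sqr_ge0// ltW.
have B0 : 0 <= 270 * w ^+ 4 * x ^+ 2 * (x ^+ 4 + u ^+ 4).
  by apply: mulr_ge0; [apply: mulr_ge0; rewrite ?sqr_ge0// mulr_ge0|rewrite addr_ge0].
have /eqP : (x ^+ 2 + u ^+ 2) ^+ 3 * (y ^+ 2 + v ^+ 2) ^+ 2 = 0 by lra.
rewrite mulf_eq0 (gt_eqF p3) /= sqrf_eq0 paddr_eq0 ?sqr_ge0// !sqrf_eq0 => /andP[/eqP y0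
  /eqP v0].
split=> //.
(* The variance of [X3] is now [w^2], so the surplus with factor [w^4 x^2] can only vanish through
   [x]. *)
have w0 : w != 0 by move: q0; rewrite y0 v0 expr0n !add0r; apply: contraTneq => ->;
  rewrite expr0n ltxx.
apply/eqP/negPn/negP => x0.
have e4_gt0 (t : R) : t != 0 -> 0 < t ^+ 4.
  by move=> tn0; rewrite lt_neqAle e4 andbT eq_sym expf_eq0.
have x2 : 0 < x ^+ 2 by rewrite lt_neqAle sqr_ge0 andbT eq_sym sqrf_eq0.
have : 0 < 270 * w ^+ 4 * x ^+ 2 * (x ^+ 4 + u ^+ 4).
  by apply: mulr_gt0; [apply: mulr_gt0 => //; apply: mulr_gt0;
    rewrite ?e4_gt0|apply: ltr_pwDl; rewrite ?e4_gt0].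
lra.
Qed.
End moment_form.

(** * Moments and cosine transform of Gaussian variables *)

(** The Radon-Nikodym derivative of the normal law agrees almost everywhere with the density,
    because both have the same integral over every measurable set. *)
Lemma ge0_integral_normal_prob (R : realType) (m s : R) (f : measurableTypeR R ->
  \bar R) :
  measurable_fun setT f -> (forall x, 0 <= f x)%E ->
  (\int[normal_prob m s]_x f x =
   \int[lebesgue_measure]_x (f x * (normal_pdf m s x)%:E))%E.
Proof.
move=> mf f0; have dom := normal_prob_dominates m s.
have mpdf : measurable_fun setT (fun x : R => (normal_pdf m s x)%:E).
  by apply/measurable_EFinP; exact: measurable_normal_pdf.
have iRN := Radon_Nikodym_SigmaFinite.f_integrable dom.
rewrite -(Radon_Nikodym_SigmaFinite.change_of_variables dom)//.
apply: ae_eq_integral => //.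
- by apply: emeasurable_funM => //; exact: measurable_int iRN.
- exact: emeasurable_funM.
- apply: ae_eqe_mul2l; apply: integral_ae_eq => //.
  by move=> E _ mE; rewrite -Radon_Nikodym_SigmaFinite.f_integral.
Qed.

(* [s = 0] covers the degenerate case. *)
Definition gaussian_mgf d (T : measurableType d) (R : realType)
    (P : probability T R) (Y : T -> R) (s : R) :=
  measurable_fun setT Y /\
  forall t, (\int[P]_w (expR (t * Y w))%:E = (expR ((t * s) ^+ 2 / 2))%:E)%E.

Lemma integral_normal_prob_expR (R : realType) (m s t : R) : 0 < s ->
  (\int[normal_prob m s]_x (expR (t * x))%:E =
   (expR (t * m + (t * s) ^+ 2 / 2))%:E)%E.
Proof.
move=> s0; have sn0 : s != 0 by rewrite gt_eqF.
rewrite ge0_integral_normal_prob; last 2 first.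
- by apply/measurable_EFinP; apply: measurableT_comp => //; exact: measurable_funM.
- by move=> x; rewrite lee_fin expR_ge0.
(* Completing the square turns the tilted density into the normal density with mean [m + t s^2]. *)
transitivity (\int[lebesgue_measure]_x
    ((expR (t * m + (t * s) ^+ 2 / 2))%:E * (normal_pdf (m + t * s ^+ 2) s x)%:E))%E.
  apply: eq_integral => x _; rewrite -!EFinM !normal_pdfE//; congr _%:E.
  rewrite mulrCA [RHS]mulrCA; congr *%R.
  by rewrite /normal_fun -!expRD; congr expR; field.
rewrite ge0_integralZl ?integral_normal_pdf ?mule1 ?lee_fin ?expR_ge0//.
- by apply/measurable_EFinP; exact: measurable_normal_pdf.
- by move=> x _; rewrite lee_fin normal_pdf_ge0.
Qed.

Lemma normal_prob_mgf (R : realType) (s : R) : 0 < s ->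
  gaussian_mgf (normal_prob 0 s) (fun x : measurableTypeR R => x) s.
Proof.
by move=> s0; split => // t; rewrite integral_normal_prob_expR// mulr0 add0r.
Qed.

Lemma centered_normal_mgf d (T : measurableType d) (R : realType)
  (P : probability T R) (Y : T -> R) (s : R) : measurable_fun setT Y ->
  centered_normal_law P Y s -> gaussian_mgf P Y s.
Proof.
move=> mY [s0 Ys]; split => // t; have [_ <-] := normal_prob_mgf s0.
have mf : measurable_fun [set: measurableTypeR R] (fun x => (expR (t * x))%:E).
  by apply/measurable_EFinP; apply: measurableT_comp => //; exact: measurable_funM.
have mY' : measurable_fun setT (Y : T -> measurableTypeR R) := mY.
have := @ge0_integral_pushforward _ _ _ _ _ _ mY' P setT _ measurableT mf.
rewrite preimage_setT => <-; last by move=> x _; rewrite lee_fin expR_ge0.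
by apply: eq_measure_integral => A mA _; exact: Ys.
Qed.

Lemma centered_gaussian_mgf d (T : measurableType d) (R : realType)
  (P : probability T R) (Y : T -> R) : measurable_fun setT Y ->
  centered_gaussian P Y -> exists s, gaussian_mgf P Y s.
Proof.
move=> mY; case=> [Y0|[s Ys]]; last by exists s; exact: centered_normal_mgf.
exists 0; split => // t; rewrite mulr0 expr0n mul0r expR0.
have mN : measurable (Y @^-1` [set 0]) by rewrite -[_ @^-1` _]setTI; exact: mY.
transitivity (\int[P]_w (cst 1%:E w))%E; last first.
  by rewrite integral_cst/= ?probability_setT ?mule1.
apply: ae_eq_integral => //.
  by apply/measurable_EFinP; apply: measurableT_comp => //; exact: measurable_funM.
exists (~` (Y @^-1` [set 0])); split; first exact: measurableC.
  have := probability_setC P mN; rewrite -[X in (1 - X)%E]/(P [set w | Y w = 0]) Y0.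
  by rewrite subee.
by move=> w /= h Yw; apply: h => _; rewrite Yw mulr0 expR0.
Qed.

Lemma geometric_sum_le2 (R : realFieldType) (t : R) n : 0 <= t -> t <= 1 / 2 ->
  \sum_(i < n) t ^+ i <= 2.
Proof.
move=> t0 t1; have tn : 0 <= t ^+ n by rewrite exprn_ge0.
have : (1 - t) * \sum_(i < n) t ^+ i <= 1.
  by rewrite -opprB mulNr -subrX1 opprB gerBl.
have S0 : 0 <= \sum_(i < n) t ^+ i by apply: sumr_ge0 => i _; rewrite exprn_ge0.
nra.
Qed.

(** Convergence at [t = 1] bounds all coefficients by some [B]. If those before [k] vanish, division
    by [t^k] leaves [c k] plus a tail of size at most [2 B t] for [0 < t <= 1/2], and [t] tends to
    [0]. *)
Lemma power_series_eq0 (R : realType) (c : R ^nat) :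
  (forall t : R, series (fun k => c k * t ^+ k) @ \oo --> (0 : R)) ->
  forall k, c k = 0.
Proof.
move=> cvg0.
have [B [B0 cB]] : exists B : R, 0 <= B /\ forall k, `|c k| <= B.
  have /cvgP/cvg_series_cvg_0/cvgP/cvg_seq_bounded := cvg0 1.
  move=> [M [Mr bM]]; exists (Num.max 0 (M + 1)); split; first by rewrite le_max lexx.
  move=> k; have /(_ _ k I) := bM (M + 1).
  by rewrite ltrDl ltr01 /= expr1n mulr1 => /(_ isT) h;
    rewrite (le_trans h)// le_max lexx orbT.
elim/ltn_ind => k IH.
suff ck t : 0 < t -> t <= 1 / 2 -> `|c k| <= 2 * B * t.
  apply/eqP; rewrite -normr_le0.
  apply/ler_addgt0Pl => e e0; rewrite addr0.
  (* The [+ 1] keeps the denominator positive when [B = 0]. *)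
  pose t := Num.min (1 / 2) (e / (2 * B + 1)).
  have t0 : 0 < t by rewrite lt_min; apply/andP; split; [lra|rewrite divr_gt0//; lra].
  apply: le_trans (ck t t0 _) _; first by rewrite ge_min lexx.
  have : t <= e / (2 * B + 1) by rewrite ge_min lexx orbT.
  rewrite ler_pdivlMr; last lra.
  by apply: le_trans; rewrite mulrC; nra.
move=> t0 t1.
have tk : 0 < t ^+ k by rewrite exprn_gt0.
rewrite -(ler_pM2r tk).
have {}cvg0 : `|series (fun k => c k * t ^+ k) n| @[n --> \oo] --> (0 : R).
  by rewrite -[X in _ --> X](@normr0 _ R); apply: cvg_norm; exact: cvg0.
rewrite -subr_le0; apply: (cvgr_to_ge cvg0).
near=> n; have kn : (k < n)%N by near: n; exact: nbhs_infty_gt.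
rewrite /series /= (big_cat_nat _ (n := k.+1))//= big_nat_recr//=.
rewrite [X in X + _ + _]big1_seq ?add0r; last first.
  by move=> i; rewrite mem_index_iota => /andP[_ /andP[_ ik]]; rewrite IH// mul0r.
rewrite -{1}[k.+1]add0n big_addn big_mkord.
set s := \sum_(i < _) _.
have sle : `|s| <= 2 * B * t * t ^+ k.
  rewrite /s (eq_bigr (fun i : 'I_(n - k.+1) => t ^+ k.+1
    * (c (i + k.+1)%N * t ^+ i))); last first.
    by move=> i _; rewrite exprD; ring.
  rewrite -mulr_sumr normrM ger0_norm ?exprn_ge0 ?(ltW t0)//.
  have : `|\sum_(i < n - k.+1) c (i + k.+1)%N * t ^+ i| <= B * 2.
    apply: le_trans (ler_norm_sum _ _ _) _.
    apply: (@le_trans _ _ (\sum_(i < n - k.+1) B * t ^+ i)).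
      apply: ler_sum => i _; rewrite normrM [`|t ^+ i|]ger0_norm ?exprn_ge0 ?(ltW t0)//.
      by rewrite ler_wpM2r ?exprn_ge0 ?(ltW t0).
    by rewrite -mulr_sumr ler_wpM2l// geometric_sum_le2// ltW.
  have tk1 : 0 <= t ^+ k.+1 by rewrite exprn_ge0// ltW.
  by move=> /(ler_wpM2l tk1)/le_trans; apply; rewrite exprS le_eqVlt; apply/orP; left;
    apply/eqP; ring.
have := lerB_normD (c k * t ^+ k) s.
rewrite normrM [`|t ^+ k|]ger0_norm ?(ltW tk)//; apply: le_trans.
by rewrite lerB.
Unshelve. all: by end_near. Qed.

(** Lets an exponential series in [t^2] be read as a power series in [t]. Among the indices below
    [n], exactly [uphalf n] are even. *)
Lemma series_even (R : realType) (a : R ^nat) (l : R) :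
  series a @ \oo --> l ->
  series (fun k => if odd k then 0 else a k./2) @ \oo --> l.
Proof.
move=> al.
have -> : series (fun k => if odd k then 0 else a k./2) = series a \o uphalf.
  apply/funext; elim=> [|n IH]; first by rewrite /series /= !big_geq.
  rewrite /series /= big_nat_recr//= -[X in X + _]/(series _ n) IH /=.
  rewrite uphalf_half; case: (odd n) => /=; first by rewrite addr0 add1n.
  by rewrite add0n /series /= big_nat_recr.
apply: cvg_comp al => A [N _ NA]; exists N.*2 => // n /= Nn; apply: NA => /=.
by rewrite -leq_double (leq_trans Nn)// -{1}[n]odd_double_half uphalf_half doubleD;
  case: (odd n).
Qed.

Lemma expR_norm_le (R : realType) (x : R) : expR `|x| <= expR x + expR (- x).
Proof.
by case: (ger0P x) => _; rewrite ?lerDl ?lerDr expR_ge0.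
Qed.

Lemma series_exp_coeff_le (R : realType) (x : R) n :
  0 <= x -> series (exp_coeff x) n <= expR x.
Proof.
move=> x0; rewrite /expR; apply: nondecreasing_cvgn_le.
  by apply: nondecreasing_series => k _ _; rewrite divr_ge0 ?exprn_ge0.
exact: is_cvg_series_exp_coeff.
Qed.

Lemma norm_exp_series_le (R : realType) (c : R ^nat) (x : R) n :
  (forall k, `|c k| <= 1) ->
  `|series (fun k => c k * x ^+ k / k`!%:R) n| <= expR `|x|.
Proof.
move=> c1; apply: le_trans (ler_norm_sum _ _ _) _.
apply: (@le_trans _ _ (series (exp_coeff `|x|) n)); last exact: series_exp_coeff_le.
apply: ler_sum => k _; rewrite normrM normfV normr_nat /exp_coeff /=.
by rewrite ler_wpM2r ?invr_ge0// normrM normrX ler_piMl ?exprn_ge0.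
Qed.

Lemma Rintegral_sum d (T : measurableType d) (R : realType)
    (mu : {measure set T -> \bar R}) (I : Type) (r : seq I) (F : I -> T -> R) :
  (forall i, mu.-integrable setT (EFin \o F i)) ->
  mu.-integrable setT (EFin \o (fun w => \sum_(i <- r) F i w)) /\
  \int[mu]_w (\sum_(i <- r) F i w) = \sum_(i <- r) \int[mu]_w F i w.
Proof.
move=> iF; elim: r => [|i r [IH1 IH2]].
  split; first by apply: eq_integrable (integrable0 _ _) => // w _ /=; rewrite big_nil.
  rewrite big_nil; under eq_Rintegral do rewrite big_nil.
  by rewrite /Rintegral integral0.
have E : (fun w => \sum_(j <- i :: r) F j w) = (fun w => F i w + \sum_(j <- r) F j w).
  by apply/funext => w; rewrite big_cons.
rewrite E; split.
  by apply: eq_integrable (integrableD _ (iF i) IH1).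
by rewrite RintegralD// IH2 big_cons.
Qed.

Lemma bounded_integrable d (T : measurableType d) (R : realType)
    (P : probability T R) (f : T -> R) (M : R) : measurable_fun setT f ->
  (forall w, `|f w| <= M) -> P.-integrable setT (EFin \o f).
Proof.
move=> mf fM; apply: (@le_integrable _ _ _ P setT _ _ (cst M%:E)) => //.
- exact/measurable_EFinP.
- by move=> w _ /=; rewrite lee_fin (le_trans (fM w))// ler_norm.
- exact: finite_measure_integrable_cst.
Qed.

Lemma measurable_cos (R : realType) : measurable_fun setT (@cos R).
Proof. apply: continuous_measurable_fun => x; exact: continuous_cos. Qed.

Lemma measurable_sin (R : realType) : measurable_fun setT (@sin R).
Proof. apply: continuous_measurable_fun => x; exact: continuous_sin. Qed.

(** For even [k] this is the double factorial of [k - 1], written as it appears in the Taylor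
    coefficients of [exp (t^2 / 2)]. *)
Definition std_moment (R : realType) (k : nat) : R :=
  if odd k then 0 else k`!%:R / (2 ^+ k./2 * (k./2)`!%:R).

Section mgf_consequences.
Context d (T : measurableType d) (R : realType) (P : probability T R).
Variables (Y : T -> R) (s : R).
Hypothesis mgfY : gaussian_mgf P Y s.
Local Notation integrable f := (P.-integrable setT (EFin \o f)).

Let mY : measurable_fun setT Y. Proof. by have [] := mgfY. Qed.

Lemma mgf_integrable t : integrable (fun w => expR (t * Y w)).
Proof.
have [_ E] := mgfY; apply/integrableP; split.
  by apply/measurable_EFinP; apply: measurableT_comp => //; exact: measurable_funM.
under eq_integral do rewrite /= ger0_norm ?expR_ge0//.
by rewrite E ltry.
Qed.

Lemma mgf_norm_integrable t : integrable (fun w => expR (t * Y w) + expR (- (t * Y w))).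
Proof.
have := integrableD measurableT (mgf_integrable t) (mgf_integrable (- t)).
by apply: eq_integrable => // w _ /=; rewrite mulNr.
Qed.

(** As [|Y|^k / k!] is a term of the series of [exp |Y|], the power is dominated by
    [k! (exp Y + exp (- Y))]. *)
Lemma mgf_power_integrable k : integrable (fun w => Y w ^+ k).
Proof.
have := integrableZl measurableT k`!%:R (mgf_norm_integrable 1).
apply: le_integrable => //.
  by apply/measurable_EFinP; exact: measurable_funX.
move=> w _ /=; rewrite lee_fin mul1r [leRHS]ger0_norm; last first.
  by rewrite mulr_ge0// addr_ge0 ?expR_ge0.
apply: (@le_trans _ _ (k`!%:R * expR `|Y w|)); last by rewrite ler_wpM2l ?expR_norm_le.
rewrite normrX -ler_pdivrMl ?ltr0n ?fact_gt0// mulrC.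
apply: le_trans (series_exp_coeff_le k.+1 (normr_ge0 (Y w))).
rewrite /series /= big_nat_recr//= lerDr sumr_ge0// => i _.
by rewrite divr_ge0 ?exprn_ge0.
Qed.

(** Termwise integration, by dominated convergence: with coefficients bounded by [1], all partial
    sums are at most [exp |t Y|]. The coefficients [c] let one proof serve [expR], [cos] and
    [sin]. *)
Lemma mgf_series_cvg (c : R ^nat) (F : R -> R) :
  (forall k, `|c k| <= 1) ->
  (forall x, series (fun k => c k * x ^+ k / k`!%:R) @ \oo --> F x) ->
  forall t, series (fun k => c k * t ^+ k / k`!%:R * \int[P]_w (Y w ^+ k)) @ \oo -->
    \int[P]_w F (t * Y w).
Proof.
move=> c1 cF t.
pose f_ n w := (series (fun k => c k * (t * Y w) ^+ k / k`!%:R) n)%:E.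
have mf_ n : measurable_fun setT (f_ n).
  apply/measurable_EFinP; apply: measurable_sum => k.
  by do 2 apply: measurable_funM => //; apply: measurable_funX; exact: measurable_funM.
have f_f w : [set: T] w -> f_ ^~ w @ \oo --> (F (t * Y w))%:E.
  by move=> _; apply: cvg_EFin; [exact: nearW|exact: cF].
have ff n w : [set: T] w -> (`|f_ n w| <= (expR (t * Y w) + expR (- (t * Y w)))%:E)%E.
  by move=> _; rewrite lee_fin (le_trans (norm_exp_series_le _ _ c1))// expR_norm_le.
have mf := emeasurable_fun_cvg _ _ mf_ f_f.
have [iF _] := dominated_convergence measurableT mf_ mf (aeW _ f_f)
  (mgf_norm_integrable t) (aeW _ (fun w n => ff n w)).
rewrite -[X in _ --> X](@fineK _ (\int[P]_x _)%E); last exact: integrable_fin_num.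
move=> /fine_cvg; apply: cvg_trans; apply: near_eq_cvg; apply: nearW => n /=.
pose G k w := c k * t ^+ k / k`!%:R * Y w ^+ k.
have iG k : integrable (G k).
  by apply: eq_integrable (integrableZl _ _ (mgf_power_integrable k)).
have [_] := Rintegral_sum (index_iota 0 n) iG.
rewrite /series /=; under [in RHS]eq_bigr do rewrite RintegralZl ?mgf_power_integrable//.
move=> <-; rewrite /Rintegral; congr fine; apply: eq_integral => w _; congr _%:E.
by apply: eq_bigr => k _; rewrite /G exprMn; ring.
Qed.

(** The moment generating function has two expansions in [t], one through the moments of [Y] and one
    through the series of [exp]; their difference is a power series converging to [0] everywhere. *)
Lemma gaussian_moment k : \int[P]_w (Y w ^+ k) = std_moment R k * s ^+ k.
Proof.
apply/eqP; rewrite -subr_eq0.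
pose c k := (\int[P]_w (Y w ^+ k) - std_moment R k * s ^+ k) / k`!%:R.
suff /(_ k)/eqP : forall k, c k = 0.
  by rewrite /c mulf_eq0 invr_eq0 pnatr_eq0 gtn_eqF ?fact_gt0 ?orbF.
apply: power_series_eq0 => t.
have -> : series (fun k => c k * t ^+ k) =
  series (fun k => 1 * t ^+ k / k`!%:R * \int[P]_w (Y w ^+ k)) -
  series (fun k => if odd k then 0 else exp_coeff ((t * s) ^+ 2 / 2) k./2).
  apply/funext => n; rewrite !fctE /series /= -sumrB; apply: eq_bigr => i _.
  rewrite /c mulrBl mulrBl; congr (_ - _); first by ring.
  rewrite /std_moment; case: ifPn => oi; first by rewrite !mul0r.
  rewrite /exp_coeff /= exprMn exprVn -exprM exprMn mul2n even_halfK//.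
  by rewrite invfM; field; rewrite !expf_neq0// ?pnatr_eq0 -?lt0n ?fact_gt0.
rewrite -[X in _ --> X](subrr (expR ((t * s) ^+ 2 / 2))); apply: cvgB.
  have [_ /(_ t) E] := mgfY.
  have <- : \int[P]_w expR (t * Y w) = expR ((t * s) ^+ 2 / 2) by rewrite /Rintegral E.
  apply: (mgf_series_cvg (c := fun=> 1)) => [i|x]; first by rewrite normr1.
  rewrite (_ : (fun k => _) = exp_coeff x); last first.
    by apply/funext => i; rewrite mul1r.
  exact: is_cvg_series_exp_coeff.
apply: series_even; exact: is_cvg_series_exp_coeff.
Qed.

Lemma gaussian_cos t : \int[P]_w cos (t * Y w) = expR (- (t * s) ^+ 2 / 2).
Proof.
pose c k : R := (~~ odd k)%:R * (-1) ^+ k./2.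
have c1 k : `|c k| <= 1.
  by rewrite /c normrM normrX normrN1 expr1n mulr1 normr_nat; case: odd.
have := mgf_series_cvg (F := cos) (t := t) c1 _.
have -> : (fun k => c k * t ^+ k / k`!%:R * \int[P]_w (Y w ^+ k)) =
    (fun k => if odd k then 0 else exp_coeff (- (t * s) ^+ 2 / 2) k./2).
  apply/funext => k; rewrite /c gaussian_moment /std_moment.
  case: ifPn => /= ok; first by rewrite !(mul0r, mulr0).
  rewrite /exp_coeff /= exprMn exprVn -[- _ ^+ 2]mulN1r exprMn -exprM exprMn mul2n
    even_halfK//.
  by field; rewrite !expf_neq0// ?pnatr_eq0 -?lt0n ?fact_gt0.
move=> /(_ _)/cvg_unique; apply => //.
  move=> x; rewrite unlock; exact: is_cvg_series_cos_coeff.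
apply: series_even; exact: is_cvg_series_exp_coeff.
Qed.

Lemma gaussian_sin t : \int[P]_w sin (t * Y w) = 0.
Proof.
pose c k : R := (odd k)%:R * (-1) ^+ k.-1./2.
have c1 k : `|c k| <= 1.
  by rewrite /c normrM normrX normrN1 expr1n mulr1 normr_nat; case: odd.
have := mgf_series_cvg (F := sin) (t := t) c1 _.
have -> : (fun k => c k * t ^+ k / k`!%:R * \int[P]_w (Y w ^+ k)) = cst 0.
  apply/funext => k; rewrite /c gaussian_moment /std_moment.
  by case: ifPn => /= ok; rewrite !(mul0r, mulr0).
move=> /(_ _)/cvg_unique; apply => //.
  move=> x; rewrite unlock; exact: is_cvg_series_sin_coeff.
have -> : series (cst (0 : R)) = cst 0 by apply/funext => n; rewrite /series /= big1.
exact: cvg_cst.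
Qed.

(** The free phase [phi] encodes the cosine and the sine transform together, which keeps the
    argument real. *)
Lemma gaussian_cos_shift t phi :
  \int[P]_w cos (t * Y w + phi) = cos phi * expR (- (t * s) ^+ 2 / 2).
Proof.
have mtY : measurable_fun setT (fun w => t * Y w) by exact: measurable_funM.
have ic : integrable (fun w => cos (t * Y w)).
  by apply: (@bounded_integrable _ _ _ _ _ 1) => [|w];
    [exact: measurableT_comp (@measurable_cos R) mtY|exact: cos_max].
have is_ : integrable (fun w => sin (t * Y w)).
  by apply: (@bounded_integrable _ _ _ _ _ 1) => [|w];
    [exact: measurableT_comp (@measurable_sin R) mtY|exact: sin_max].
under eq_Rintegral do rewrite cosD.
rewrite RintegralB// ?RintegralZr// ?gaussian_cos ?gaussian_sin; first by ring.
- by apply: eq_integrable (integrableZr _ (cos phi) ic).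
- by apply: eq_integrable (integrableZr _ (sin phi) is_).
Qed.

End mgf_consequences.

(** * Independence of uncorrelated Gaussian variables *)

(** Chernoff's bound with exponent [t = 1] or [t = -1], for the upper or the lower tail:
    [1_A <= exp (t (x - m) - a)], and the mean of [exp (t (x - m))] is [exp (1/2)]. *)
Lemma markov_exp (R : realType) (m a t : R) (A : set (measurableTypeR R)) : measurable A
  ->
  t ^+ 2 = 1 -> (forall x, A x -> a <= t * (x - m)) ->
  fine (normal_prob m 1 A) <= expR (1 / 2 - a).
Proof.
move=> mA t1 Aa; rewrite -lee_fin fineK ?fin_num_measure//.
have -> : (normal_prob m 1 A = \int[normal_prob m 1]_x (\1_A x)%:E)%E.
  by rewrite integral_indic// setIT.
have -> : ((expR (1 / 2 - a))%:E =
   \int[normal_prob m 1]_x ((expR (- (t * m) - a))%:E * (expR (t * x))%:E))%E.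
  rewrite ge0_integralZl ?lee_fin ?expR_ge0//.
  - rewrite integral_normal_prob_expR// -EFinM -expRD; congr (expR _)%:E.
    by rewrite mulr1 t1; ring.
  - by apply/measurable_EFinP; apply: measurableT_comp => //; exact: measurable_funM.
apply: ge0_le_integral => //.
- by apply/measurable_EFinP; exact: measurable_indic.
- apply: emeasurable_funM => //; apply/measurable_EFinP.
  by apply: measurableT_comp => //; exact: measurable_funM.
- move=> x _; rewrite -EFinM lee_fin -expRD indicE.
  have [xA|_] := boolP (x \in A); last exact: expR_ge0.
  rewrite -[leLHS]expR0 ler_expR; move: xA; rewrite inE => /Aa; lra.
Qed.

(** The standard Gaussian is, up to a constant, its own Fourier transform. *)
Lemma normal_pdf_cos (R : realType) (m y : R) :
  normal_pdf m 1 y = normal_peak 1 * \int[normal_prob 0 1]_z cos ((y - m) * z).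
Proof.
rewrite normal_pdfE ?oner_eq0//; congr *%R.
rewrite (gaussian_cos (normal_prob_mgf ltr01)) /normal_fun mulr1.
by congr expR; rewrite expr1n mulr2n.
Qed.

Lemma integral_swap0 d1 d2 (T1 : measurableType d1) (T2 : measurableType d2)
    (R : realType) (m1 : {sigma_finite_measure set T1 -> \bar R})
    (m2 : {sigma_finite_measure set T2 -> \bar R}) (f : T1 * T2 -> R) (M : R) :
  measurable_fun setT f ->
  (\int[m1]_x \int[m2]_y `|(f (x, y))%:E| <= M%:E)%E ->
  (forall y, \int[m1]_x (f (x, y))%:E = 0)%E ->
  (\int[m1]_x \int[m2]_y (f (x, y))%:E = 0)%E.
Proof.
move=> mf fM f0; have mf' : measurable_fun setT (EFin \o f) by exact/measurable_EFinP.
rewrite (@Fubini _ _ _ _ _ m1 m2 (EFin \o f)); last first.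
  by apply/integrable12ltyP => //=; rewrite (le_lt_trans fM)// ltry.
by apply: integral0_eq => y _; exact: f0.
Qed.

Lemma integral_probability_cst d (T : measurableType d) (R : realType)
  (P : probability T R) (c : R) : (\int[P]_w c%:E = c%:E)%E.
Proof. by have := expectation_cst P c; rewrite unlock. Qed.

(* The shift [n] makes the limit [0], not [1 / 2], at [x = b]. *)
Lemma cvg_normal_prob_tail (R : realType) (b x : R) :
  fine (normal_prob (n%:R ^+ 2 * x) 1 `]n%:R ^+ 2 * b + n%:R, +oo[) @[n --> \oo] -->
  (\1_(`]b, +oo[ : set R) x : R).
Proof.
have cvgE : expR (1 / 2 - n%:R : R) @[n --> \oo] --> (0 : R).
  rewrite -[X in _ --> X](mulr0 (expR (1 / 2))); under eq_fun do rewrite expRD.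
  by apply: cvgM; [exact: cvg_cst|exact: cvgn_expR].
have [xb|bx] := leP x b.
  rewrite indicE memNset ?mulr0n;
    last by rewrite /= in_itv /= andbT => /(le_lt_trans xb); rewrite ltxx.
  apply: (squeeze_cvgr _ (cvg_cst 0) cvgE); apply: nearW => n.
  rewrite fine_ge0//=; apply: (markov_exp (t := 1)) => //; first by rewrite expr1n.
  move=> y; rewrite /= in_itv /= andbT => yb; rewrite mul1r.
  have := ler_wpM2l (sqr_ge0 (n%:R : R)) xb; lra.
rewrite indicE mem_set ?mulr1n; last by rewrite /= in_itv /= andbT.
have cvg1 : (1 - expR (1 / 2 - n%:R)) @[n --> \oo] --> (1 : R).
  by rewrite -[X in _ --> X]subr0; apply: cvgB => //; exact: cvg_cst.
have cvg1' : (1 : R) @[_ --> \oo] --> (1 : R) by exact: cvg_cst.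
apply: (squeeze_cvgr _ cvg1 cvg1'); near=> n.
set A := (X in fine (normal_prob _ _ X)).
have mA : measurable A by exact: measurable_itv.
have NA : normal_prob (n%:R ^+ 2 * x) 1 A \is a fin_num by exact: fin_num_measure.
apply/andP; split; last first.
  by rewrite -lee_fin fineK//; exact: probability_le1.
have := @markov_exp R (n%:R ^+ 2 * x) n%:R (- 1) (~` A) (measurableC mA).
rewrite probability_setC// fineB//= => h.
suff : 1 - fine (normal_prob (n%:R ^+ 2 * x) 1 A) <= expR (1 / 2 - n%:R) by lra.
apply: h => [|y]; first by rewrite sqrrN expr1n.
rewrite /A /= in_itv /= andbT => /negP; rewrite -leNgt mulN1r => yb.
have n0 : (0 : R) <= n%:R by [].
(* Then [n^2 (x - b) >= 2 n], so the threshold [n^2 b + n] lies at least [n] below the mean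
   [n^2 x]. *)
have nb : 2 / (x - b) <= n%:R.
  near: n; exact: nbhs_infty_ger.
rewrite ler_pdivrMr ?subr_gt0// in nb.
have := ler_wpM2l n0 nb; lra.
Unshelve. all: by end_near. Qed.

(* The Gaussian density is an average of cosines, so [W] is orthogonal to
   [normal_pdf (al * X) 1 y], hence to normal tails, hence to rays. *)
Section characteristic_uniqueness.
Context d (T : measurableType d) (R : realType) (P : probability T R).
Variables (W X : T -> R) (M : R).
Hypothesis mW : measurable_fun setT W.
Hypothesis mX : measurable_fun setT X.
Hypothesis WM : forall w, `|W w| <= M.
Hypothesis WX : forall t phi, \int[P]_w (W w * cos (t * X w + phi)) = 0.

Let M0 : 0 <= M.
Proof.
have [T0|/set0P[w _]] := eqVneq [set: T] set0; last exact: le_trans (WM w).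
by have := probability_setT P; rewrite T0 measure0 => /esym/eqP; rewrite onee_eq0.
Qed.

Let integrableW (f : T -> R) : measurable_fun setT f -> (forall w, `|f w| <= 1) ->
  P.-integrable setT (EFin \o (fun w => W w * f w)).
Proof.
move=> mf f1; apply: (@bounded_integrable _ _ _ _ _ M); first exact: measurable_funM.
by move=> w; rewrite normrM -[leRHS]mulr1 ler_pM.
Qed.

Let EWf_eq0 (f : T -> R) : measurable_fun setT f -> (forall w, `|f w| <= 1) ->
  \int[P]_w (W w * f w) = 0 -> (\int[P]_w (W w * f w)%:E = 0)%E.
Proof.
by move=> mf f1 E; rewrite -[LHS]fineK ?[fine _]E// integrable_fin_num// integrableW.
Qed.

(** Scaling [X] by a large [al] does the work of a small standard deviation, so that only densities
    with standard deviation [1] occur. *)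
Let uniq_pdf (al y : R) : (\int[P]_w (W w * normal_pdf (al * X w) 1 y)%:E = 0)%E.
Proof.
pose N : probability _ R := normal_prob (0 : R) 1.
pose pk : R := normal_peak 1.
have pk0 : 0 <= pk by exact: normal_peak_ge0.
pose f (p : T * measurableTypeR R) := W p.1 * pk * cos ((y - al * X p.1) * p.2).
have mcos : measurable_fun setT (fun p : T * measurableTypeR R => cos ((y
  - al * X p.1) * p.2)).
  apply: measurableT_comp; first exact: measurable_cos.
  apply: measurable_funM => //; apply: measurable_funB => //.
  by apply: measurable_funM => //; exact: measurableT_comp mX measurable_fst.
have mf : measurable_fun setT f.
  apply: measurable_funM => //; apply: measurable_funM => //.
  exact: measurableT_comp mW measurable_fst.
have : (\int[P]_w \int[N]_z (f (w, z))%:E = 0)%E.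
  apply: (@integral_swap0 _ _ _ _ _ P N f (M * pk)) => //.
    apply: (@le_trans _ _ (\int[P]_w \int[N]_z (M * pk)%:E))%E; last first.
      under eq_integral do rewrite integral_probability_cst.
      by rewrite integral_probability_cst.
    apply: ge0_le_integral => //.
    - by move=> w _; exact: integral_ge0.
    - apply: (measurable_fun_fubini_tonelli_F (abse \o (EFin \o f))) => //=.
      by do 2 apply: measurableT_comp => //.
    - move=> w _; apply: ge0_le_integral => //.
      + do 2 apply: measurableT_comp => //.
        by apply: measurableT_comp mf _; exact: pair1_measurable.
      + move=> z _; rewrite /= lee_fin normrM -[leRHS]mulr1 ler_pM ?cos_max//.
        by rewrite normrM (ger0_norm pk0) ler_wpM2r.
  move=> z; have mz : measurable_fun setT (fun w => cos ((y - al * X w) * z)).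
    exact: measurableT_comp mcos (pair2_measurable z).
  transitivity (\int[P]_w (pk%:E * (W w * cos ((y - al * X w) * z))%:E))%E.
    by apply: eq_integral => w _; rewrite -EFinM /f /=; congr _%:E; ring.
  have cos1 w : `|cos ((y - al * X w) * z)| <= 1 by exact: cos_max.
  rewrite integralZl ?EWf_eq0 ?mule0//; last exact: integrableW.
  rewrite -[RHS](WX (- (al * z)) (y * z)); apply: eq_Rintegral => w _ /=.
  by congr (_ * cos _); ring.
move=> <-; apply: eq_integral => w _; rewrite normal_pdf_cos -/pk.
have ic : N.-integrable setT (EFin \o (fun z => cos ((y - al * X w) * z))).
  apply: (@bounded_integrable _ _ _ _ _ 1) => [|z]; last exact: cos_max.
  exact: measurableT_comp mcos (pair1_measurable w).
transitivity (\int[N]_z ((W w * pk)%:E * (cos ((y - al * X w) * z))%:E))%E.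
  by rewrite integralZl// mulrA EFinM /Rintegral fineK// integrable_fin_num.
by apply: eq_integral => z _; rewrite -EFinM.
Qed.

Let tail (al c : R) w := fine (normal_prob (al * X w) 1 `]c, +oo[).

Let uniq_tail (al c : R) : measurable_fun setT (tail al c) /\
  (\int[P]_w (W w * tail al c w)%:E = 0)%E.
Proof.
pose A : set (measurableTypeR R) := `]c, +oo[%classic.
have mA : measurable A by exact: measurable_itv.
pose g (p : T * measurableTypeR R) := normal_pdf (al * X p.1) 1 p.2 * \1_A p.2.
have g0 p : 0 <= g p by rewrite mulr_ge0 ?normal_pdf_ge0.
have mg : measurable_fun setT g.
  apply: measurable_funM; last exact: measurableT_comp measurable_snd.
  rewrite (_ : (fun p => _) = (fun p : T * measurableTypeR R =>
     normal_peak 1 * expR (- (p.2 - al * X p.1) ^+ 2 / (1 ^+ 2 *+ 2)))); last first.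
    by apply/funext => p; rewrite normal_pdfE ?oner_eq0.
  apply: measurable_funM => //; apply: measurableT_comp => //.
  apply: measurable_funM => //; apply: measurableT_comp => //.
  apply: measurable_funX; apply: measurable_funB; first exact: measurable_snd.
  by apply: measurable_funM => //; exact: measurableT_comp mX measurable_fst.
have gE w : (\int[lebesgue_measure]_y (g (w, y))%:E = normal_prob (al * X w) 1 A)%E.
  rewrite /normal_prob [RHS]integral_mkcond; apply: eq_integral => y _.
  by rewrite epatch_indic -EFinM.
have tE w : (tail al c w)%:E = normal_prob (al * X w) 1 A.
  by rewrite fineK//; exact: fin_num_measure.
have mt : measurable_fun setT (tail al c).
  apply/measurable_EFinP; rewrite (_ : EFin \o _ = fubini_F lebesgue_measure (EFin \o g)).
    by apply: measurable_fun_fubini_tonelli_F; [exact/measurable_EFinP|move=> p;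
      rewrite lee_fin].
  by apply/funext => w; rewrite /= /fubini_F tE -gE.
split => //.
pose f (p : T * measurableTypeR R) := W p.1 * g p.
have mf : measurable_fun setT f.
  by apply: measurable_funM => //; exact: measurableT_comp mW measurable_fst.
have mg1 w : measurable_fun setT (fun y => (g (w, y))%:E).
  by apply/measurable_EFinP; exact: measurableT_comp mg (pair1_measurable w).
have : (\int[P]_w \int[lebesgue_measure]_y (f (w, y))%:E = 0)%E.
  apply: (@integral_swap0 _ _ _ _ _ P lebesgue_measure f M) => //.
    apply: (@le_trans _ _ (\int[P]_w M%:E)%E); last by rewrite integral_probability_cst.
    apply: ge0_le_integral => //.
    - by move=> w _; exact: integral_ge0.
    - apply: (measurable_fun_fubini_tonelli_F (abse \o (EFin \o f))) => //=.
      by do 2 apply: measurableT_comp => //.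
    - move=> w _; apply: (@le_trans _ _ (\int[lebesgue_measure]_y (M%:E
      * (g (w, y))%:E))%E).
        apply: ge0_le_integral => //.
        + do 2 apply: measurableT_comp => //.
          exact: measurableT_comp mf (pair1_measurable w).
        + exact: emeasurable_funM.
        + move=> y _; rewrite /= -EFinM lee_fin normrM (ger0_norm (g0 _)).
          by rewrite ler_wpM2r.
      rewrite ge0_integralZl ?lee_fin//; last by move=> y _; rewrite lee_fin.
      by rewrite gE -[leRHS]mule1 lee_wpmul2l ?lee_fin//; exact: probability_le1.
  move=> y; rewrite /f /g /=.
  have [yA|yA] := boolP (y \in A).
    rewrite -[RHS](uniq_pdf al y); apply: eq_integral => w _.
    by rewrite indicE yA mulr1.
  by apply: integral0_eq => w _; rewrite indicE (negbTE yA) !mulr0.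
move=> <-; apply: eq_integral => w _; rewrite EFinM tE -gE.
have ig : lebesgue_measure.-integrable [set: measurableTypeR R] (fun y => (g (w, y))%:E).
  apply/integrableP; split => //; under eq_integral do rewrite /= ger0_norm//.
  by rewrite gE ltey_eq fin_num_measure.
rewrite -(integralZl _ ig)//; apply: eq_integral => y _; by rewrite -EFinM.
Qed.

Let tail_le1 al c w : `|tail al c w| <= 1.
Proof.
rewrite ger0_norm ?fine_ge0// -lee_fin fineK ?fin_num_measure//; exact: probability_le1.
Qed.

Let uniq_ray (b : R) : \int[P]_w (W w * \1_(`]b, +oo[ : set R) (X w)) = 0.
Proof.
pose t n := tail (n%:R ^+ 2) (n%:R ^+ 2 * b + n%:R).
pose f_ n w := (W w * t n w)%:E.
pose f w := (W w * \1_(`]b, +oo[ : set R) (X w))%:E.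
have mf_ n : measurable_fun setT (f_ n).
  by apply/measurable_EFinP; apply: measurable_funM => //;
    have [] := uniq_tail (n%:R ^+ 2) (n%:R ^+ 2 * b + n%:R).
have f_f w : [set: T] w -> f_ ^~ w @ \oo --> f w.
  move=> _; apply: cvg_EFin; first exact: nearW.
  by apply: cvgM; [exact: cvg_cst|exact: cvg_normal_prob_tail].
have ff n w : [set: T] w -> (`|f_ n w| <= M%:E)%E.
  by move=> _; rewrite lee_fin normrM -[leRHS]mulr1 ler_pM ?tail_le1.
have mf := emeasurable_fun_cvg _ _ mf_ f_f.
have iM : P.-integrable setT (EFin \o cst M) by exact: finite_measure_integrable_cst.
have [_ _] := dominated_convergence measurableT mf_ mf (aeW _ f_f) iM (aeW _ (fun w n =>
  ff n w)).
rewrite (_ : (fun n => _) = cst 0%E); last first.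
  by apply/funext => n; have [] := uniq_tail (n%:R ^+ 2) (n%:R ^+ 2 * b + n%:R).
by move=> /cvg_unique/(_ (cvg_cst _)) h; rewrite /Rintegral h.
Qed.

(** Uniqueness of characteristic functions for the signed measure [W dP] pushed forward by [X]. Rays
    are stable under intersection and generate the Borel sets, so Dynkin's lemma extends the
    vanishing from rays to all of them. *)
Lemma bounded_char_uniqueness (A : set R) : measurable A ->
  \int[P]_w (W w * \1_A (X w)) = 0.
Proof.
have m1 (B : set R) : measurable B -> measurable_fun setT (\1_B \o X : T -> R).
  by move=> mB; apply: measurableT_comp.
have b1 (B : set R) w : `|(\1_B \o X : T -> R) w| <= 1.
  by rewrite /= indicE normr_nat lern1 leq_b1.
have i1 (B : set R) (mB : measurable B) := integrableW (m1 B mB) (b1 B).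
(* Frequency [0] gives mean [0], used for the whole line and for complements in the Dynkin
   induction. *)
have W0 : \int[P]_w W w = 0.
  rewrite -[RHS](WX 0 0); apply: eq_Rintegral => w _.
  by rewrite mul0r addr0 cos0 mulr1.
have iW : P.-integrable setT (EFin \o W).
  by apply: (@bounded_integrable _ _ _ _ _ M).
move=> mA; have sA : <<s (@RGenOInfty.G R) >> A.
  by have : (@ocitv R).-sigma.-measurable A := mA; rewrite RGenOInfty.measurableE.
move: sA; apply: (@dynkin_induction _ (measurableTypeR R) (@RGenOInfty.G R)
  (fun A : set R => \int[P]_w (W w * \1_A (X w)) = 0)).
- exact: RGenOInfty.measurableE.
- move=> _ _ [x ->] [y ->]; exists (Num.max x y).
  by apply/seteqP; split => z /=; rewrite !in_itv /= !andbT gt_max;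
    [move=> [-> ->]|move=> /andP[-> ->]].
- by under eq_Rintegral do rewrite indicT mulr1.
- by move=> _ [b ->]; exact: uniq_ray.
- move=> S mS S0.
  have C z : \1_(~` S) z = 1 - \1_S z :> R.
    by rewrite !indicE in_setC; case: (z \in S); rewrite ?subrr ?subr0.
  under eq_Rintegral => w _ do rewrite C mulrBr mulr1.
  by rewrite RintegralB// ?S0 ?W0 ?subr0//; exact: i1.
- move=> F mF tF F0.
  have E (B : set R) : \int[P]_w (W w * \1_B (X w)) = \int[P]_(w in X @^-1` B) W w.
    by rewrite [RHS]Rintegral_mkcond; apply: eq_Rintegral => w _; rewrite patch_indic.
  have mXB (B : set R) : measurable B -> measurable (X @^-1` B).
    by move=> mB; rewrite -[_ @^-1` _]setTI; exact: mX.
  have iWB (B : set R) : measurable B -> P.-integrable (X @^-1` B) (EFin \o W).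
    by move=> mB; apply: integrableS iW => //; exact: mXB.
  rewrite E /Rintegral preimage_bigcup integral_bigcup//.
  + rewrite eseries0// => k _ _.
    have fin := integrable_fin_num (mXB _ (mF k)) (iWB _ (mF k)).
    by rewrite -(fineK fin) -[fine _]/(Rintegral P (X @^-1` F k) W) -E F0.
  + move=> i j _ _ [w [Fi Fj]]; apply: tF => //.
    by exists (X w); split.
  + by move=> k; exact: mXB (mF k).
  + by rewrite -preimage_bigcup; apply: iWB; exact: bigcupT_measurable.
Qed.

End characteristic_uniqueness.

Section gaussian_independence.
Context d (T : measurableType d) (R : realType) (P : probability T R).
Variables (X1 X2 X3 : T -> R) (Q1 : R -> R) (Q2 : R -> R -> R).
Hypothesis mX1 : measurable_fun setT X1.
Hypothesis mX2 : measurable_fun setT X2.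
Hypothesis mX3 : measurable_fun setT X3.
Hypothesis charX : forall a b c phi,
  \int[P]_w cos (a * X1 w + b * X2 w + c * X3 w + phi) =
  cos phi * expR (- (Q1 a + Q2 b c)).
Hypothesis Q1N : forall a, Q1 (- a) = Q1 a.
Hypothesis Q10 : Q1 0 = 0.
Hypothesis Q20 : Q2 0 0 = 0.
Local Notation integrable f := (P.-integrable setT (EFin \o f)).

Let mlin a b c phi : measurable_fun setT (fun w => a * X1 w + b * X2 w + c * X3 w + phi).
Proof.
apply: measurable_funD => //; apply: measurable_funD; last exact: measurable_funM.
by apply: measurable_funD; exact: measurable_funM.
Qed.

Let mcos a b c phi : measurable_fun setT (fun w => cos (a * X1 w + b * X2 w + c * X3 w
  + phi)).
Proof. exact: measurableT_comp (@measurable_cos R) (mlin _ _ _ _). Qed.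

Let icos a b c phi : integrable (fun w => cos (a * X1 w + b * X2 w + c * X3 w + phi)).
Proof. by apply: (@bounded_integrable _ _ _ _ _ 1) => // w; exact: cos_max. Qed.

Let cosM (x y : R) : cos x * cos y = (cos (x + y) + cos (x - y)) / 2.
Proof. by rewrite cosD cosB; field. Qed.

(** With [V] the centered indicator of [X1] in [A1], the claim is that [V] is orthogonal to the
    product of the indicators for [X2] and [X3]. The cosines in the transform are traded for
    indicators one variable at a time, by three uses of [bounded_char_uniqueness]. *)
Lemma gaussian_independence (A1 A2 A3 : set R) :
  measurable A1 -> measurable A2 -> measurable A3 ->
  P (X1 @^-1` A1 `&` X2 @^-1` A2 `&` X3 @^-1` A3) =
  (P (X1 @^-1` A1) * P (X2 @^-1` A2 `&` X3 @^-1` A3))%E.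
Proof.
move=> mA1 mA2 mA3.
have mI (X : T -> R) A : measurable_fun setT X -> measurable A ->
    measurable_fun setT (\1_A \o X : T -> R).
  by move=> mX mA; exact: measurableT_comp.
have I1 (X : T -> R) A w : `|(\1_A \o X : T -> R) w| <= 1.
  by rewrite /= indicE normr_nat lern1 leq_b1.
have iI (X : T -> R) A : measurable_fun setT X -> measurable A ->
  integrable (\1_A \o X : T -> R).
  by move=> mX mA; apply: (@bounded_integrable _ _ _ _ _ 1); [exact: mI|exact: I1].
pose p1 := \int[P]_w \1_A1 (X1 w).
pose V w := \1_A1 (X1 w) - p1.
have mV : measurable_fun setT V by apply: measurable_funB => //; exact: mI.
have V2 w : `|V w| <= 1 + `|p1| by rewrite (le_trans (ler_normB _ _))// lerD2r; exact: I1.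
have iV (f : T -> R) : measurable_fun setT f -> (forall w, `|f w| <= 1) ->
  integrable (fun w => V w * f w).
  move=> mf f1; apply: (@bounded_integrable _ _ _ _ _ (1 + `|p1|));
    first exact: measurable_funM.
  by move=> w; rewrite normrM -[leRHS]mulr1 ler_pM.
have H1 b c phi : \int[P]_w (V w * cos (b * X2 w + c * X3 w + phi)) = 0.
  have E w : cos (b * X2 w + c * X3 w + phi) = cos (0 * X1 w + b * X2 w + c * X3 w + phi).
    by congr cos; ring.
  pose W w := cos (0 * X1 w + b * X2 w + c * X3 w + phi) - cos phi * expR (- Q2 b c).
  have mW : measurable_fun setT W by exact: measurable_funB.
  have WM w : `|W w| <= 1 + `|cos phi * expR (- Q2 b c)|.
    by rewrite (le_trans (ler_normB _ _))// lerD2r cos_max.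
  have WX t psi : \int[P]_w (W w * cos (t * X1 w + psi)) = 0.
    (* Product to sum gives the frequencies [t] and [- t] in [X1]. As [Q1] is even, the two terms
       combine to [cos phi * cos psi] times an exponential, which the subtracted mean cancels. *)
    transitivity (\int[P]_w (2^-1 * cos (t * X1 w + b * X2 w + c * X3 w + (phi + psi)) +
      2^-1 * cos ((- t) * X1 w + b * X2 w + c * X3 w + (phi - psi)) -
      (cos phi * expR (- Q2 b c)) * cos (t * X1 w + 0 * X2 w + 0 * X3 w + psi))).
      apply: eq_Rintegral => w _; rewrite /W mulrBl cosM mulrDl ![_ / 2]mulrC.
      congr (_ * cos _ + _ * cos _ - _ * cos _); ring.
    rewrite RintegralB ?RintegralD ?RintegralZl//; first last.
    - by apply: eq_integrable (integrableZl _ _ (icos _ _ _ _)).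
    - by apply: eq_integrable (integrableD _ (integrableZl _ 2^-1 (icos _ _ _ _))
      (integrableZl _ 2^-1 (icos _ _ _ _))).
    - by apply: eq_integrable (integrableZl _ _ (icos _ _ _ _)).
    - by apply: eq_integrable (integrableZl _ _ (icos _ _ _ _)).
    rewrite !charX Q1N Q20 addr0 !opprD expRD cosD cosB; by field.
  have := bounded_char_uniqueness mW mX1 WM WX mA1.
  rewrite /W; under eq_Rintegral do rewrite mulrBl.
  rewrite RintegralB//; first last.
  - by apply: eq_integrable (integrableZl _ _ (iI X1 A1 mX1 mA1)).
  - apply: (@bounded_integrable _ _ _ _ _ 1); first by apply: measurable_funM => //;
    exact: mI.
    by move=> w; rewrite normrM -[leRHS]mulr1 ler_pM ?cos_max//; exact: I1.
  rewrite RintegralZl//; last exact: iI.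
  rewrite -/p1 => <-; rewrite /V; under eq_Rintegral => w _ do rewrite mulrBl E mulrC.
  rewrite RintegralB//; first last.
  - by apply: eq_integrable (integrableZl _ p1 (icos _ _ _ _)).
  - apply: (@bounded_integrable _ _ _ _ _ 1); first by apply: measurable_funM => //;
    exact: mI.
    by move=> w; rewrite normrM -[leRHS]mulr1 ler_pM ?cos_max//; exact: I1.
  by rewrite RintegralZl// charX Q10 add0r [p1 * _]mulrC.
(* Now the weight is [V] times a cosine of [X3], and [H1] supplies its orthogonality to the cosines
   of [X2]. *)
have H2 c phi : \int[P]_w (V w * \1_A2 (X2 w) * cos (c * X3 w + phi)) = 0.
  pose W w := V w * cos (0 * X1 w + 0 * X2 w + c * X3 w + phi).
  have mW : measurable_fun setT W by exact: measurable_funM.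
  have WM w : `|W w| <= 1 + `|p1|.
    by rewrite normrM -[leRHS]mulr1 ler_pM ?cos_max.
  have WX t psi : \int[P]_w (W w * cos (t * X2 w + psi)) = 0.
    transitivity (\int[P]_w (2^-1
      * (V w * cos (0 * X1 w + t * X2 w + c * X3 w + (phi + psi))) +
      2^-1 * (V w * cos (0 * X1 w + (- t) * X2 w + c * X3 w + (phi - psi))))).
      apply: eq_Rintegral => w _; rewrite /W -mulrA cosM.
      have -> : forall x y : R, V w * ((x + y) / 2) = 2^-1 * (V w * x) + 2^-1 * (V w * y).
        by move=> x y; ring.
      by congr (_ * (_ * cos _) + _ * (_ * cos _)); ring.
    have iVc a b e f := iV _ (mcos a b e f) (fun w => cos_max _).
    rewrite RintegralD ?RintegralZl//; first last.
    - by apply: eq_integrable (integrableZl _ _ (iVc _ _ _ _)).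
    - by apply: eq_integrable (integrableZl _ _ (iVc _ _ _ _)).
    rewrite -[RHS](addr0 0); congr (_ + _); rewrite -[RHS](mulr0 2^-1); congr (_ * _).
      rewrite -[RHS](H1 t c (phi + psi)); apply: eq_Rintegral => w _.
      by congr (_ * cos _); ring.
    rewrite -[RHS](H1 (- t) c (phi - psi)); apply: eq_Rintegral => w _.
    by congr (_ * cos _); ring.
  rewrite -[RHS](bounded_char_uniqueness mW mX2 WM WX mA2); apply: eq_Rintegral => w _.
  by rewrite /W mulrAC; congr (_ * cos _ * _); ring.
have H3 : \int[P]_w (V w * \1_A2 (X2 w) * \1_A3 (X3 w)) = 0.
  apply: (bounded_char_uniqueness (W := fun w => V w * \1_A2 (X2 w)) (M := 1
    + `|p1|)) => //.
    by apply: measurable_funM => //; exact: mI.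
  by move=> w; rewrite normrM -[leRHS]mulr1 ler_pM//; exact: I1.
have mP (X : T -> R) A : measurable_fun setT X -> measurable A -> measurable (X @^-1` A).
  by move=> mX mA; rewrite -[_ @^-1` _]setTI; exact: mX.
have PE (B : set T) : measurable B -> P B = (\int[P]_w \1_B w)%:E.
  move=> mB; rewrite /Rintegral integral_indic// setIT fineK//; exact: fin_num_measure.
have m23 : measurable (X2 @^-1` A2 `&` X3 @^-1` A3) by apply: measurableI; exact: mP.
have p1E : p1 = \int[P]_w \1_(X1 @^-1` A1) w by apply: eq_Rintegral.
rewrite !PE//; [|exact: mP|by rewrite -setIA; apply: measurableI => //; exact: mP].
rewrite -EFinM -p1E; congr _%:E; apply/eqP; rewrite -subr_eq0 -RintegralZl//; last first.
  by apply: integrable_indic.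
have m123 : measurable (X1 @^-1` A1 `&` X2 @^-1` A2 `&` X3 @^-1` A3).
  by rewrite -setIA; apply: measurableI => //; exact: mP.
have i123 := integrable_indic P m123.
have i23 : integrable (fun w => p1 * \1_(X2 @^-1` A2 `&` X3 @^-1` A3) w).
  by apply: eq_integrable (integrableZl _ p1 (integrable_indic P m23)).
rewrite -RintegralB//.
apply/eqP; rewrite -[RHS]H3; apply: eq_Rintegral => w _.
by rewrite /V !indicI -!/(_ \o _) /=; ring.
Qed.

End gaussian_independence.

(** * Mixed moments *)

Lemma polynomial_fun_eq0 (R : realType) (n : nat) (c : R ^nat) :
  (forall t : R, \sum_(k < n) c k * t ^+ k = 0) -> forall k, (k < n)%N -> c k = 0.
Proof.
move=> c0 k kn; pose c' k := if (k < n)%N then c k else 0.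
suff : c' k = 0 by rewrite /c' kn.
apply: power_series_eq0 => t; apply: cvg_near_cst; near=> N.
have nN : (n <= N)%N by near: N; exact: nbhs_infty_ge.
rewrite /series /= (big_cat_nat _ (n := n))//= [X in _ + X]big1_seq ?addr0; last first.
  by move=> i; rewrite mem_index_iota => /andP[_ /andP[ni _]];
    rewrite /c' ltnNge ni mul0r.
rewrite big_mkord -[RHS](c0 t); apply: eq_bigr => i _; by rewrite /c' ltn_ord.
Unshelve. all: by end_near. Qed.

Lemma sum_even (R : realType) (a : R ^nat) N :
  \sum_(k < N.*2.+1) (if odd k then 0 else a k./2) = \sum_(k < N.+1) a k.
Proof.
elim: N => [|N IH]; first by rewrite !big_ord_recl !big_ord0.
rewrite doubleS big_ord_recr /= big_ord_recr /= IH [RHS]big_ord_recr /=.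
by rewrite odd_double /= addr0 doubleK.
Qed.

Lemma std_moment_even (R : realType) k :
  std_moment R k.*2 = (k.*2)`!%:R / (2 ^+ k * k`!%:R).
Proof. by rewrite /std_moment odd_double doubleK. Qed.

Lemma std_moment_odd (R : realType) k : odd k -> std_moment R k = 0.
Proof. by rewrite /std_moment => ->. Qed.

Lemma std_moment_gt0 (R : realType) k : 0 < std_moment R k.*2.
Proof.
by rewrite std_moment_even divr_gt0 ?mulr_gt0 ?exprn_gt0// ltr0n fact_gt0.
Qed.

Lemma std_momentS (R : realType) k :
  std_moment R k.+1.*2 = (k.*2.+1)%:R * std_moment R k.*2.
Proof.
rewrite !std_moment_even doubleS !factS !natrM exprS.
have k0 : k.+1%:R != 0 :> R by rewrite pnatr_eq0.
have f0 : k`!%:R != 0 :> R by rewrite pnatr_eq0 -lt0n fact_gt0.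
have -> : (k.*2.+2)%:R = 2 * k.+1%:R :> R by rewrite -doubleS -mul2n natrM.
have p0 : 2 ^+ k != 0 :> R by rewrite expf_neq0 ?pnatr_eq0.
move: (k.+1%:R : R) (k`!%:R : R) (2 ^+ k : R) k0 f0 p0 => x y z x0 y0 z0.
by field; rewrite x0 y0 z0.
Qed.

(** Both sides equal [(2N)! / (2^N k! (N - k)!)]. This matches the expansion of the [2N]-th power of
    a sum with the expansion of the [N]-th power of its variance. *)
Lemma std_moment_bin (R : realType) N k : (k <= N)%N ->
  std_moment R N.*2 * 'C(N, k)%:R =
  'C(N.*2, k.*2)%:R * (std_moment R k.*2 * std_moment R (N - k).*2).
Proof.
move=> kN; rewrite !std_moment_even.
have F j : j`!%:R != 0 :> R by rewrite pnatr_eq0 -lt0n fact_gt0.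
have E1 : 'C(N, k)%:R = N`!%:R / (k`!%:R * (N - k)`!%:R) :> R.
  by rewrite -natrM -(bin_fact kN) natrM mulfK// natrM mulf_neq0.
have E2 : 'C(N.*2, k.*2)%:R = (N.*2)`!%:R / ((k.*2)`!%:R * ((N - k).*2)`!%:R) :> R.
  by rewrite doubleB -natrM -(bin_fact (n := N.*2) (m := k.*2)) ?leq_double// natrM
    mulfK// natrM mulf_neq0.
rewrite E1 E2 -[in 2 ^+ N](subnKC kN) exprD.
by field; rewrite !F !expf_neq0 ?pnatr_eq0.
Qed.

Section moments.
Context d (T : measurableType d) (R : realType) (P : probability T R).
Local Notation integrable f := (P.-integrable setT (EFin \o f)).

(** Unlike integrability, this property is stable under products as well as sums, so every
    polynomial in such functions is integrable. *)
Definition all_moments (f : T -> R) :=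
  measurable_fun setT f /\ forall n, integrable (fun w => f w ^+ n).

Lemma all_moments_integrable f : all_moments f -> integrable f.
Proof.
by case=> _ /(_ 1%N); apply: eq_integrable => // w _ /=; rewrite expr1.
Qed.

Let all_moments_dominated (f g : T -> R) : measurable_fun setT f ->
  integrable g -> (forall w, `|f w| <= g w) -> integrable f.
Proof.
move=> mf ig fg; apply: le_integrable ig => //; first exact/measurable_EFinP.
by move=> w _ /=; rewrite lee_fin (le_trans (fg w))// ler_norm.
Qed.

Lemma all_momentsM f g : all_moments f -> all_moments g ->
  all_moments (fun w => f w * g w).
Proof.
move=> [mf If] [mg Ig]; split => [|n]; first exact: measurable_funM.
apply: (@all_moments_dominated _ (fun w => f w ^+ n.*2 + g w ^+ n.*2)).
- by apply: measurable_funX; exact: measurable_funM.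
- by apply: eq_integrable (integrableD _ (If n.*2) (Ig n.*2)).
- move=> w; rewrite exprMn normrM -!muln2 !exprM
    -(real_normK (num_real (f w ^+ n))) -(real_normK (num_real (g w ^+ n))).
  have := sqr_ge0 (`|f w ^+ n| - `|g w ^+ n|).
  have := sqr_ge0 (`|f w ^+ n|); have := sqr_ge0 (`|g w ^+ n|); nra.
Qed.

Lemma all_momentsX f k : all_moments f -> all_moments (fun w => f w ^+ k).
Proof.
move=> [mf If]; split => [|n]; first exact: measurable_funX.
by have := If (k * n)%N; apply: eq_integrable => // w _ /=; rewrite exprM.
Qed.

Lemma all_moments_cst (c : R) : all_moments (fun=> c).
Proof. by split => // n; apply: finite_measure_integrable_cst. Qed.

Lemma all_momentsD f g : all_moments f -> all_moments g ->
  all_moments (fun w => f w + g w).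
Proof.
move=> mf mg; split => [|n]; first by apply: measurable_funD; [case: mf|case: mg].
have iF (k : 'I_n.+1) : integrable (fun w => 'C(n, k)%:R * (f w ^+ (n - k) * g w ^+ k)).
  apply: all_moments_integrable; apply: all_momentsM; first exact: all_moments_cst.
  by apply: all_momentsM; exact: all_momentsX.
have [+ _] := Rintegral_sum (index_enum (ordinal n.+1)) iF.
apply: eq_integrable => // w _ /=; congr _%:E; rewrite exprDn.
by apply: eq_bigr => k _; rewrite mulr_natl.
Qed.

Lemma mgf_all_moments f s : gaussian_mgf P f s -> all_moments f.
Proof. by move=> h; split => [|n]; [case: h|exact: mgf_power_integrable h n]. Qed.

(* Both sides of the hypothesis are polynomials in [a]: compare coefficients. *)
Lemma weighted_moment_coef (G Y Z : T -> R) (g sig tau : R) :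
  all_moments G -> all_moments Y -> all_moments Z ->
  (forall a n, \int[P]_w (G w * (a * Y w + Z w) ^+ n) =
     g * (std_moment R n * (sig * a ^+ 2 + tau) ^+ n./2)) ->
  forall i j, \int[P]_w (G w * (Y w ^+ i * Z w ^+ j)) =
     g * (std_moment R i * sig ^+ i./2 * (std_moment R j * tau ^+ j./2)).
Proof.
move=> mG mY mZ H i j; pose n := (i + j)%N.
have mYZ k l : all_moments (fun w => G w * (Y w ^+ k * Z w ^+ l)).
  by do 2 (apply: all_momentsM => //); exact: all_momentsX.
pose c k := 'C(n, k)%:R * (\int[P]_w (G w * (Y w ^+ k * Z w ^+ (n - k))) -
  g * (std_moment R k * sig ^+ k./2 * (std_moment R (n - k) * tau ^+ (n - k)./2))).
have : c i = 0; last first.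
  rewrite /c /n addKn => /eqP; rewrite mulf_eq0 pnatr_eq0 -leqn0 leqNgt bin_gt0 leq_addr
    /=.
  by rewrite subr_eq0 => /eqP.
apply: (@polynomial_fun_eq0 _ n.+1); last by rewrite ltnS leq_addr.
move=> a; transitivity (\int[P]_w (G w * (a * Y w + Z w) ^+ n) -
    g * (std_moment R n * (sig * a ^+ 2 + tau) ^+ n./2)); last by rewrite H subrr.
under eq_bigr => k _ do rewrite /c mulrBr mulrBl.
rewrite sumrB; congr (_ - _).
  have iYZ k : all_moments (fun w => 'C(n, k)%:R * a ^+ k * (G w
    * (Y w ^+ k * Z w ^+ (n - k)))).
    by apply: all_momentsM => //; exact: all_moments_cst.
  transitivity (\sum_(k < n.+1) \int[P]_w
      ('C(n, k)%:R * a ^+ k * (G w * (Y w ^+ k * Z w ^+ (n - k))))).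
    apply: eq_bigr => k _; rewrite RintegralZl//; last exact: all_moments_integrable.
    by rewrite mulrAC.
  have [_ E] := Rintegral_sum (index_enum (ordinal n.+1))
    (fun k : 'I_n.+1 => all_moments_integrable (iYZ k)).
  apply: etrans (esym E) _.
  apply: eq_Rintegral => w _; rewrite addrC exprDn mulr_sumr; apply: eq_bigr => k _.
  by rewrite exprMn -mulr_natr; ring.
have [on|/even_halfK nE] := boolP (odd n).
  rewrite [in RHS]std_moment_odd// mul0r mulr0 big1// => k _.
  have [ok|ek] := boolP (odd k); first by rewrite std_moment_odd//; ring.
  have kn : (k <= n)%N by rewrite -ltnS.
  by rewrite (std_moment_odd _ (k := n - k)) ?oddB// ?on ?(negbTE ek)//; ring.
rewrite -nE doubleK; set N := n./2.
pose A k := g * (std_moment R N.*2 * ('C(N, k)%:R * (tau ^+ (N - k)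
  * (sig * a ^+ 2) ^+ k))).
have AE j' : (j' <= N)%N -> 'C(N.*2, j'.*2)%:R *
    (g * (std_moment R j'.*2 * sig ^+ j' *
      (std_moment R (N.*2 - j'.*2) * tau ^+ (N.*2 - j'.*2)./2))) * a ^+ j'.*2 = A j'.
  move=> jN; rewrite /A -doubleB doubleK.
  transitivity (g * (std_moment R N.*2 * 'C(N, j')%:R) *
    (tau ^+ (N - j') * (sig * a ^+ 2) ^+ j')); last by ring.
  have -> : a ^+ j'.*2 = (a ^+ 2) ^+ j' by rewrite -mul2n exprM.
  have reorder (x y z t u v e : R) :
    x * (y * (z * t * (u * v))) * e = y * (x * (z * u)) * (v * (t * e)) by ring.
  by rewrite std_moment_bin// [(sig * _) ^+ _]exprMn reorder.
transitivity (\sum_(k < N.*2.+1) (if odd k then 0 else A k./2)).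
  apply: eq_bigr => k _; case: ifPn => [ok|/even_halfK kE];
    first by rewrite std_moment_odd//; ring.
  have kN : (k./2 <= N)%N by rewrite -leq_double kE -ltnS.
  by have := AE _ kN; rewrite kE.
rewrite sum_even /A -!mulr_sumr addrC exprDn; congr (_ * (_ * _)).
by apply: eq_bigr => k _; rewrite mulr_natl.
Qed.

(** The variables are separated one at a time: comparing coefficients in [a] with weight [1]
    isolates [Y ^+ i], which then becomes the weight when coefficients in [b] are compared. *)
Lemma mixed_moment (Y Z V : T -> R) (s1 s2 s3 : R) :
  all_moments Y -> all_moments Z -> all_moments V ->
  (forall a b c n, \int[P]_w ((a * Y w + b * Z w + c * V w) ^+ n) =
     std_moment R n * (a ^+ 2 * s1 + b ^+ 2 * s2 + c ^+ 2 * s3) ^+ n./2) ->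
  forall i j k, \int[P]_w (Y w ^+ i * Z w ^+ j * V w ^+ k) =
    std_moment R i * s1 ^+ i./2 * (std_moment R j * s2 ^+ j./2)
      * (std_moment R k * s3 ^+ k./2).
Proof.
move=> mY mZ mV H i j k.
have mlin b c : all_moments (fun w => b * Z w + c * V w).
  by apply: all_momentsD; apply: all_momentsM => //; exact: all_moments_cst.
rewrite -mulrA; under eq_Rintegral do rewrite -mulrA.
apply: (weighted_moment_coef (G := fun w => Y w ^+ i)) => //; first exact: all_momentsX.
move=> b n.
have E : forall c, \int[P]_w (1 * (Y w ^+ i * (b * Z w + c * V w) ^+ n)) =
  1 * (std_moment R i * s1 ^+ i./2 * (std_moment R n
    * (b ^+ 2 * s2 + c ^+ 2 * s3) ^+ n./2)).
  move=> c; apply: (weighted_moment_coef (G := fun=> 1)) => //;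
    first exact: all_moments_cst.
  move=> a l; rewrite mul1r; under eq_Rintegral do rewrite mul1r addrA.
  by rewrite H; congr (_ * _ ^+ _); ring.
move: (E 1); rewrite mul1r expr1n mul1r [s2 * _]mulrC => <-.
by apply: eq_Rintegral => w _; rewrite !mul1r.
Qed.
End moments.

(** * Expansion of the joint moment into the moment form *)

Lemma std_moment_shift (R : realType) m k :
  std_moment R (2 * m.+1 + 2 * k) = std_moment R (2 * m.+1) * biased_moment m%:R k.
Proof.
rewrite /biased_moment; elim: k => [|k IH]; first by rewrite big_ord0 addn0 mulr1.
have -> : (2 * m.+1 + 2 * k.+1)%N = (m.+1 + k).+1.*2 by rewrite -mulnDr mul2n addnS.
rewrite big_ord_recr /= mulrA -IH std_momentS -mul2n mulnDr mulrC; congr (_ * _).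
by rewrite -addn1 -[m.+1]addn1 !natrD; ring.
Qed.

Lemma std_moment_values (R : realType) :
  [/\ std_moment R 0 = 1, std_moment R 2 = 1, std_moment R 4 = 3,
      std_moment R 6 = 15 & std_moment R 8 = 105] /\ std_moment R 10 = 945.
Proof.
have e k := std_momentS R k.
have s0 : std_moment R 0 = 1 by rewrite /std_moment /= fact0 expr0 mulr1 divr1.
have s2 : std_moment R 2 = 1 by rewrite -[RHS](mul1r 1) -{2}s0; exact: e 0.
have s4 : std_moment R 4 = 3 by rewrite [LHS](e 1 : _ = 3 * std_moment R 2) s2 mulr1.
have s6 : std_moment R 6 = 15 by rewrite [LHS](e 2 : _ = 5 * std_moment R 4) s4; ring.
have s8 : std_moment R 8 = 105 by rewrite [LHS](e 3 : _ = 7 * std_moment R 6) s6; ring.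
split => //; rewrite [LHS](e 4 : _ = 9 * std_moment R 8) s8; ring.
Qed.

Lemma std_moment_odd_values (R : realType) :
  [/\ std_moment R 1 = 0, std_moment R 3 = 0, std_moment R 5 = 0,
      std_moment R 7 = 0 & std_moment R 9 = 0].
Proof. by split; exact: std_moment_odd. Qed.

Ltac compute_nat f :=
  repeat match goal with |- context [f ?n ?k] =>
    let v := eval vm_compute in (f n k) in change (f n k) with v end.

(** Here [N i j] plays the biased moment of [Y^i U^j] with [Y = s X] and [U = u G], and [S r] that
    of [(a Y + U)^6 (b Y + c U)^r]. Sums over explicit lists unfold by computation, which leaves a
    ring identity. *)
Lemma binary_expansion (R : realType) (n : R) (a b c s u : R) (N : nat -> nat -> R) :
  (forall i j, N i j =
     (if odd i then 0 else biased_moment n i./2 * s ^+ i) * (std_moment R j * u ^+ j)) ->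
  let S r := \sum_(i <- iota 0 7) \sum_(j <- iota 0 r.+1)
    'C(6, i)%:R * a ^+ (6 - i) * ('C(r, j)%:R * b ^+ (r - j) * c ^+ j) *
    N ((6 - i) + (r - j))%N (i + j)%N in
  [/\ S 4 = moment64 (a * s) u (b * s) (c * u) n, S 2 = moment62 (a * s) u (b * s) (c *
    u) n
    & S 0 = moment60 ((a * s) ^+ 2) (u ^+ 2) n].
Proof.
move=> NE S.
have [[k0 k2 k4 k6 k8] k10] := std_moment_values R.
have [k1 k3 k5 k7 k9] := std_moment_odd_values R.
have mu0 : biased_moment n 0 = 1 by rewrite /biased_moment big_ord0.
split; rewrite /S; cbn [iota]; rewrite !big_cons !big_nil;
 compute_nat subn; compute_nat addn; compute_nat binomial; rewrite !NE;
   cbn [odd negb half uphalf];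
 rewrite ?(k0,k1,k2,k3,k4,k5,k6,k7,k8,k9,k10,mu0).
- rewrite /moment64 /coef64_4 /coef64_3 /coef64_2 /coef64_1 /coef64_0 /=; ring.
- rewrite /moment62 /coef62_2 /coef62_1 /coef62_0 /=; ring.
- rewrite /moment60 /=; ring.
Qed.

Lemma exprD_iota (R : comNzRingType) (x y : R) n :
  (x + y) ^+ n = \sum_(i <- iota 0 n.+1) 'C(n, i)%:R * (x ^+ (n - i) * y ^+ i).
Proof.
rewrite exprDn -(big_mkord xpredT (fun i => x ^+ (n - i) * y ^+ i *+ 'C(n, i))).
by rewrite /index_iota subn0; apply: eq_bigr => i _; rewrite mulr_natl.
Qed.

Section joint_moment.
Context d (T : measurableType d) (R : realType) (P : probability T R).
Variables (Y U V : T -> R) (s u w : R).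
Hypothesis mY : all_moments P Y.
Hypothesis mU : all_moments P U.
Hypothesis mV : all_moments P V.
Hypothesis YUV : forall a b c n, \int[P]_t ((a * Y t + b * U t + c * V t) ^+ n) =
  std_moment R n * (a ^+ 2 * s ^+ 2 + b ^+ 2 * u ^+ 2 + c ^+ 2 * w ^+ 2) ^+ n./2.

Let monomial i j k : \int[P]_t (Y t ^+ i * U t ^+ j * V t ^+ k) =
  std_moment R i * s ^+ i * (std_moment R j * u ^+ j) * (std_moment R k * w ^+ k).
Proof.
have E n (x : R) : std_moment R n * (x ^+ 2) ^+ n./2 = std_moment R n * x ^+ n.
  have [on|/even_halfK nE] := boolP (odd n); first by rewrite std_moment_odd// !mul0r.
  by rewrite -exprM mul2n nE.
by rewrite (mixed_moment mY mU mV YUV) !E.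
Qed.

Let mmono i j k : all_moments P (fun t => Y t ^+ i * U t ^+ j * V t ^+ k).
Proof. by do 2 (apply: all_momentsM; last exact: all_momentsX); exact: all_momentsX. Qed.

Variable m : nat.

Let N i j := (if odd i then 0 else biased_moment m%:R i./2 * s ^+ i)
  * (std_moment R j * u ^+ j).

Let monomialE i j k : \int[P]_t (Y t ^+ (2 * m.+1 + i) * U t ^+ j * V t ^+ k) =
  std_moment R (2 * m.+1) * s ^+ (2 * m.+1) * (std_moment R k * w ^+ k) * N i j.
Proof.
rewrite monomial /N exprD; case: ifPn => [oi|/even_halfK iE].
  by rewrite (std_moment_odd _ (k := (2 * m.+1 + i)%N)) ?oddD ?oddM ?oi//; ring.
by rewrite -{1}iE -mul2n std_moment_shift; ring.
Qed.

Let form a b c r t := Y t ^+ (2 * m.+1) * (a * Y t + U t) ^+ 6 * (b * Y t + c * U t) ^+ r.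

Let mform a b c r k : all_moments P (fun t => form a b c r t * V t ^+ k).
Proof.
have ml x y : all_moments P (fun t => x * Y t + y * U t).
  by apply: all_momentsD; apply: all_momentsM => //; exact: all_moments_cst.
apply: all_momentsM; last exact: all_momentsX.
apply: all_momentsM; last by apply: all_momentsX.
apply: all_momentsM; apply: all_momentsX => //.
by apply: all_momentsD => //; apply: all_momentsM => //; exact: all_moments_cst.
Qed.

Let form_moment a b c r k : \int[P]_t (form a b c r t * V t ^+ k) =
  std_moment R (2 * m.+1) * s ^+ (2 * m.+1) * (std_moment R k * w ^+ k) *
  \sum_(i <- iota 0 7) \sum_(j <- iota 0 r.+1)
    'C(6, i)%:R * a ^+ (6 - i) * ('C(r, j)%:R * b ^+ (r - j) * c ^+ j) *
    N ((6 - i) + (r - j))%N (i + j)%N.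
Proof.
pose C i j := 'C(6, i)%:R * a ^+ (6 - i) * ('C(r, j)%:R * b ^+ (r - j) * c ^+ j).
pose F i j t := C i j *
  (Y t ^+ (2 * m.+1 + ((6 - i) + (r - j))) * U t ^+ (i + j) * V t ^+ k).
have iF i j : P.-integrable setT (EFin \o F i j).
  by apply: all_moments_integrable; apply: all_momentsM => //; exact: all_moments_cst.
have SF i := Rintegral_sum (iota 0 r.+1) (iF i).
transitivity (\int[P]_t \sum_(i <- iota 0 7) \sum_(j <- iota 0 r.+1) F i j t).
  apply: eq_Rintegral => t _; rewrite /form [(_
    + U t) ^+ 6]exprD_iota mulr_sumr !mulr_suml.
  apply: eq_bigr => i _; rewrite exprD_iota mulr_sumr mulr_suml; apply: eq_bigr => j _.
  by rewrite /F /C !exprMn !exprD; ring.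
have [_ ->] := Rintegral_sum (iota 0 7) (fun i => (SF i).1).
rewrite mulr_sumr; apply: eq_bigr => i _; rewrite (SF i).2 mulr_sumr;
  apply: eq_bigr => j _.
rewrite /F RintegralZl//; last exact: all_moments_integrable.
by rewrite monomialE mulrCA.
Qed.

(** In the expansion of the fourth power along [V], odd powers integrate to [0]; the powers [0],
    [2], [4] give the weights [1], [6 w^2] and [3 w^4] of [moment_form]. *)
Lemma joint_moment a b c :
  \int[P]_t (Y t ^+ (2 * m.+1) * (a * Y t + U t) ^+ 6 * (b * Y t + c * U t + V t) ^+ 4) =
  std_moment R (2 * m.+1) * s ^+ (2 * m.+1) * moment_form (a * s) u (b * s) (c * u) w
    m%:R.
Proof.
pose F k t := 'C(4, k)%:R * (form a b c (4 - k) t * V t ^+ k).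
have iF k : P.-integrable setT (EFin \o F k).
  by apply: all_moments_integrable; apply: all_momentsM => //; exact: all_moments_cst.
transitivity (\int[P]_t \sum_(k <- iota 0 5) F k t).
  apply: eq_Rintegral => t _; rewrite [(_ + V t) ^+ 4]exprD_iota mulr_sumr.
  by apply: eq_bigr => k _; rewrite /F /form; ring.
have [_ ->] := Rintegral_sum (iota 0 5) iF.
have E k : \int[P]_t F k t = 'C(4, k)%:R * \int[P]_t (form a b c (4 - k) t * V t ^+ k).
  by rewrite RintegralZl//; exact: all_moments_integrable.
cbn [iota]; rewrite !big_cons big_nil !E !form_moment.
have [[k0 k2 k4 _ _] _] := std_moment_values R.
have [k1 k3 _ _ _] := std_moment_odd_values R.
have [S4 S2 S0] := @binary_expansion R m%:R a b c s u N (fun i j => erefl).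
compute_nat subn; rewrite k0 k1 k2 k3 k4 S4 S2 S0 /moment_form.
compute_nat binomial; ring.
Qed.

End joint_moment.

(** The joint law is the product of the marginal laws, so the integral over the second variable can
    be taken first, where it is [x] times the mean of [Y]. *)
Lemma independent_integralM (d : measure_display) (T : measurableType d) (R : realType)
    (P : probability T R) (X Y : {RV P >-> R}) :
  (forall A B : set R, measurable A -> measurable B ->
    P (X @^-1` A `&` Y @^-1` B) = (P (X @^-1` A) * P (Y @^-1` B))%E) ->
  P.-integrable setT (EFin \o (Y : T -> R)) ->
  P.-integrable setT (EFin \o (fun w => X w * Y w)) ->
  \int[P]_w Y w = 0 -> \int[P]_w (X w * Y w) = 0.
Proof.
move=> ind iY iXY Y0.
pose Zf w := (X w, Y w).
have mZ : measurable_fun setT Zf by exact: measurable_fun_pair.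
pose Z : {mfun T >-> (R * R)%type} := HB.pack Zf (isMeasurableFun.Build _ _ _ _ Zf mZ).
pose f (p : R * R) := (p.1 * p.2)%:E.
have mf : measurable_fun setT f.
  apply/measurable_EFinP; apply: measurable_funM;
    [exact: measurable_fst|exact: measurable_snd].
have E : forall A, measurable A ->
    (distribution P X \x distribution P Y)%E A = distribution P Z A.
  by apply: product_measure_unique => A B mA mB; exact: ind.
have iZ : (distribution P Z).-integrable setT f by exact: integrable_pushforward.
have ip : (distribution P X \x distribution P Y)%E.-integrable setT f.
  have /integrableP[_ foo] := iZ; apply/integrableP; split => //.
  rewrite (eq_measure_integral (distribution P Z))// => A mA _; exact: E.
suff : (\int[distribution P Z]_p f p = 0)%E.
  by rewrite (integral_distribution (X := Z) mf iXY) => h; rewrite /Rintegral h.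
transitivity (\int[(distribution P X \x distribution P Y)%E]_p f p)%E.
  by apply: eq_measure_integral => A mA _; exact/esym/E.
rewrite -integral12_prod_meas1//; apply: integral0_eq => x _; rewrite /fubini_F /f /=.
have iY' : (distribution P Y).-integrable setT (EFin : R -> \bar R).
  by apply: integrable_pushforward => //; exact/measurable_EFinP.
under eq_integral do rewrite EFinM.
rewrite integralZl// (integral_distribution (X := Y))//.
by rewrite -[X in (_ * X)%E]fineK ?[fine _]Y0 ?mule0//; exact: integrable_fin_num.
Qed.

(** * Covariances and Gram-Schmidt coordinates of a Gaussian vector *)

Section gaussian_vector.
Context d (T : measurableType d) (R : realType) (P : probability T R).
Variables X1 X2 X3 : {RV P >-> R}.
Hypothesis GX : centered_gaussian_vector3 P X1 X2 X3.

Let lin a b c w := a * X1 w + b * X2 w + c * X3 w.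

Let lin_mgf a b c : exists s, gaussian_mgf P (lin a b c) s.
Proof.
apply: centered_gaussian_mgf; last exact: GX.
apply: measurable_funD; last exact: measurable_funM.
by apply: measurable_funD; exact: measurable_funM.
Qed.

Let mlin a b c : all_moments P (lin a b c).
Proof. by have [s] := lin_mgf a b c; exact: mgf_all_moments. Qed.

Lemma gaussian_all_moments :
  [/\ all_moments P X1, all_moments P X2 & all_moments P X3].
Proof.
split; [have := mlin 1 0 0|have := mlin 0 1 0|have := mlin 0 0 1];
  by congr all_moments; apply/funext => w; rewrite /lin; ring.
Qed.

Let c11 := \int[P]_w (X1 w * X1 w).
Let c22 := \int[P]_w (X2 w * X2 w).
Let c33 := \int[P]_w (X3 w * X3 w).
Let c12 := \int[P]_w (X1 w * X2 w).
Let c13 := \int[P]_w (X1 w * X3 w).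
Let c23 := \int[P]_w (X2 w * X3 w).
Let Q a b c := a ^+ 2 * c11 + b ^+ 2 * c22 + c ^+ 2 * c33 +
  2 * (a * b * c12 + a * c * c13 + b * c * c23).

Let QE a b c : \int[P]_w (lin a b c w ^+ 2) = Q a b c.
Proof.
have [m1 m2 m3] := gaussian_all_moments.
pose F k w := match k with
  | 0%N => a ^+ 2 * (X1 w * X1 w) | 1%N => b ^+ 2 * (X2 w * X2 w)
  | 2%N => c ^+ 2 * (X3 w * X3 w) | 3%N => (2 * a * b) * (X1 w * X2 w)
  | 4%N => (2 * a * c) * (X1 w * X3 w) | _ => (2 * b * c) * (X2 w * X3 w) end.
have iF k : P.-integrable setT (EFin \o F k).
  apply: all_moments_integrable.
  by case: k => [|[|[|[|[|k]]]]]; rewrite /F; (apply: all_momentsM;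
    [exact: all_moments_cst|exact: all_momentsM]).
transitivity (\int[P]_w \sum_(k <- iota 0 6) F k w).
  by apply: eq_Rintegral => w _; cbn [iota]; rewrite !big_cons big_nil /F /lin; ring.
have [_ ->] := Rintegral_sum (iota 0 6) iF; cbn [iota]; rewrite !big_cons big_nil /F.
rewrite !RintegralZl ?(all_moments_integrable (all_momentsM _ _))//.
by rewrite -/c11 -/c22 -/c33 -/c12 -/c13 -/c23 /Q; ring.
Qed.

Let lin_std a b c : exists s, gaussian_mgf P (lin a b c) s /\ s ^+ 2 = Q a b c.
Proof.
have [s ms] := lin_mgf a b c; exists s; split => //.
have [[_ k2 _ _ _] _] := std_moment_values R.
by rewrite -QE (gaussian_moment ms) k2 mul1r.
Qed.

Let Q_ge0 a b c : 0 <= Q a b c.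
Proof. by have [s [_ <-]] := lin_std a b c; exact: sqr_ge0. Qed.

Let lin_moment a b c n : \int[P]_w (lin a b c w ^+ n) = std_moment R n * Q a b c ^+ n./2.
Proof.
have [s [ms <-]] := lin_std a b c; rewrite (gaussian_moment ms).
have [on|/even_halfK nE] := boolP (odd n); first by rewrite std_moment_odd// !mul0r.
by rewrite -exprM mul2n nE.
Qed.

Let lin_cos a b c phi : \int[P]_w cos (lin a b c w
  + phi) = cos phi * expR (- (Q a b c / 2)).
Proof.
have [s [ms <-]] := lin_std a b c; have := gaussian_cos_shift ms 1 phi.
rewrite mul1r mulNr => <-; apply: eq_Rintegral => w _; by rewrite mul1r.
Qed.

Lemma gaussian_integral0 : [/\ \int[P]_w X1 w = 0, \int[P]_w X2 w = 0 & \int[P]_w X3 w =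
  0].
Proof.
have odd1 a b c : \int[P]_w lin a b c w = 0.
  have := lin_moment a b c 1; rewrite std_moment_odd// mul0r => <-.
  by apply: eq_Rintegral => w _; rewrite expr1.
by split; [rewrite -(odd1 1 0 0)|rewrite -(odd1 0 1 0)|rewrite -(odd1 0 0 1)];
  apply: eq_Rintegral => w _; rewrite /lin; ring.
Qed.

(** Without [c12] and [c13] the variance splits as [Q a 0 0 + Q 0 b c], so the cosine transform
    factors. Only [X1] is separated from the pair, which allows a second use after a permutation. *)
Lemma uncorrelated_independent : c12 = 0 -> c13 = 0 -> forall A1 A2 A3 : set R,
  measurable A1 -> measurable A2 -> measurable A3 ->
  P (X1 @^-1` A1 `&` X2 @^-1` A2 `&` X3 @^-1` A3) =
  (P (X1 @^-1` A1) * P (X2 @^-1` A2 `&` X3 @^-1` A3))%E.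
Proof.
move=> c12_0 c13_0.
apply: (gaussian_independence (Q1 := fun a => Q a 0 0 / 2) (Q2 := fun b c => Q 0 b c /
  2)) => //.
- move=> a b c phi; rewrite -[LHS]/(\int[P]_w cos (lin a b c w + phi)) lin_cos.
  by congr (_ * expR (- _)); rewrite /Q c12_0 c13_0; field.
- by move=> a; rewrite /Q; field.
- by rewrite /Q; ring.
- by rewrite /Q; ring.
Qed.

Lemma gaussian_even_moments n : [/\ \int[P]_w (X1 w ^+ n.*2) = std_moment R n.*2 * c11
  ^+ n,
  \int[P]_w (X2 w ^+ n.*2) = std_moment R n.*2 * c22 ^+ n
  & \int[P]_w (X3 w ^+ n.*2) = std_moment R n.*2 * c33 ^+ n].
Proof.
have E a b c : \int[P]_w (lin a b c w ^+ n.*2) = std_moment R n.*2 * Q a b c ^+ n.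
  by rewrite lin_moment doubleK.
have -> : c11 = Q 1 0 0 by rewrite /Q; ring.
have -> : c22 = Q 0 1 0 by rewrite /Q; ring.
have -> : c33 = Q 0 0 1 by rewrite /Q; ring.
by split; rewrite -E; apply: eq_Rintegral => w _; congr (_ ^+ _); rewrite /lin; ring.
Qed.

(* [x, y], [u, v] and [w] are the coordinates of [X2, X3] along the normalized
   Gram-Schmidt basis of [X1, X2, X3]; the basis vectors may vanish. *)
Lemma gaussian_joint_moment m : 0 < c11 -> exists x u y v w : R,
  [/\ \int[P]_t (X1 t ^+ (2 * m.+1) * X2 t ^+ 6 * X3 t ^+ 4) =
        std_moment R (2 * m.+1) * c11 ^+ m.+1 * moment_form x u y v w m%:R,
      c22 = x ^+ 2 + u ^+ 2, c33 = y ^+ 2 + v ^+ 2 + w ^+ 2 &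
      [/\ x = 0, y = 0 & v = 0] <-> [/\ c12 = 0, c13 = 0 & c23 = 0]].
Proof.
move=> c11_gt0; have c11n0 : c11 != 0 by rewrite gt_eqF.
pose a := c12 / c11; pose b := c13 / c11.
pose q := c22 - c12 ^+ 2 / c11; pose e := c23 - c12 * c13 / c11.
pose r := c33 - c13 ^+ 2 / c11.
have q0 : 0 <= q.
  by have := Q_ge0 (- a) 1 0; congr (0 <= _); rewrite /Q /q /a; field.
(* The variance of [t X2 + X3] after removal of its component along [X1]. *)
have psd t : 0 <= q * t ^+ 2 + 2 * e * t + r.
  have := Q_ge0 (- (a * t) - b) t 1; congr (0 <= _).
  by rewrite /Q /q /e /r /a /b; field.
pose c := e / q.
have cq : c * q = e.
  have [q00|qn0] := eqVneq q 0; last by rewrite /c divfK.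
  rewrite q00 mulr0; apply/esym/eqP/negPn/negP => e0.
  (* If [q = 0], the residual variance is affine in [t], and this [t] would give it the value [-1];
     hence [e = 0], in accordance with [c = e / 0 = 0]. *)
  have := psd (- (r + 1) / (2 * e)); rewrite q00.
  have -> : 0 * (- (r + 1) / (2 * e)) ^+ 2 + 2 * e
    * (- (r + 1) / (2 * e)) + r = -1 by field.
  by rewrite ler0N1.
pose l := r - c ^+ 2 * q.
have l0 : 0 <= l.
  have := psd (- c); congr (0 <= _); rewrite /l -cq; ring.
pose s := Num.sqrt c11; pose u := Num.sqrt q; pose w := Num.sqrt l.
have s2 : s ^+ 2 = c11 by rewrite sqr_sqrtr// ltW.
have u2 : u ^+ 2 = q by rewrite sqr_sqrtr.
have w2 : w ^+ 2 = l by rewrite sqr_sqrtr.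
have sn0 : s != 0 by rewrite gt_eqF// sqrtr_gt0.
pose U t := X2 t - a * X1 t; pose V t := X3 t - b * X1 t - c * U t.
have UE : U = lin (- a) 1 0 by apply/funext => t; rewrite /U /lin; ring.
have VE : V = lin (c * a - b) (- c) 1 by apply/funext => t; rewrite /V /U /lin; ring.
have [mX1 _ _] := gaussian_all_moments.
have mU : all_moments P U by rewrite UE.
have mV : all_moments P V by rewrite VE.
(* These are read off [X2 = a X1 + U] and [X3 = b X1 + c U + V], where [X1], [U], [V] have standard
   deviations [s], [u], [w]. *)
exists (a * s), u, (b * s), (c * u), w; split.
- rewrite -s2 -exprM -(@joint_moment _ _ _ P X1 U V s u w mX1 mU mV); last first.
    move=> f g h n.
    transitivity (\int[P]_t (lin (f - g * a + h * (c * a - b)) (g - h * c) h t ^+ n)).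
      by apply: eq_Rintegral => t _; congr (_ ^+ _); rewrite /U /V /U /lin; ring.
    rewrite lin_moment s2 u2 w2; congr (_ * _ ^+ _).
    have c22E : c22 = q + c12 ^+ 2 / c11 by rewrite /q subrK.
    have c23E : c23 = c * q + c12 * c13 / c11 by rewrite cq /e subrK.
    have c33E : c33 = r + c13 ^+ 2 / c11 by rewrite /r subrK.
    by rewrite /Q /l /a /b c22E c23E c33E; move: (q) (r) (c) => ? ? ?; field.
  by apply: eq_Rintegral => t _; congr (_ * _ ^+ _ * _ ^+ _); rewrite /V /U; ring.
- by rewrite exprMn s2 u2 /q /a; field.
- by rewrite [(b * s) ^+ 2]exprMn [(c * u) ^+ 2]exprMn s2 u2 w2 /l /r /b;
  move: (q) (c) => ? ?; field.
- split=> [[as0 bs0 cu0]|[c120 c130 c230]].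
    have c120 : c12 = 0.
      by move/eqP: as0; rewrite /a !mulf_eq0 (negbTE sn0) invr_eq0 (negbTE c11n0) !orbF
        => /eqP.
    have c130 : c13 = 0.
      by move/eqP: bs0; rewrite /b !mulf_eq0 (negbTE sn0) invr_eq0 (negbTE c11n0) !orbF
        => /eqP.
    split=> //; have : e = 0 by rewrite -cq -u2 expr2 mulrA cu0 mul0r.
    by rewrite /e c120 !mul0r subr0.
  by rewrite /a /b /c /e c120 c130 c230 !mul0r subr0 !mul0r.
Qed.

End gaussian_vector.

Lemma integral_sqr_gt0 (d : measure_display) (T : measurableType d) (R : realType)
    (P : probability T R) (X : {RV P >-> R}) s :
  centered_normal_law P X s -> 0 < \int[P]_w (X w * X w).
Proof.
move=> Xs; have s0 := Xs.1.
have ms : gaussian_mgf P X s by apply: centered_normal_mgf.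
have [[_ k2 _ _ _] _] := std_moment_values R.
rewrite -[X in 0 < X]/(\int[P]_w (X w ^+ 2)).
by rewrite (gaussian_moment ms) k2 mul1r exprn_gt0.
Qed.

Theorem theorem4p1 (d : measure_display) (T : measurableType d) (R : realType)
  (P : probability T R) (X1 X2 X3 : {RV P >-> R}) (m : nat) :
  (0 < m)%N ->
  centered_gaussian_vector3 P X1 X2 X3 ->
  (exists s1 : R, centered_normal_law P X1 s1) ->
  (exists s2 : R, centered_normal_law P X2 s2) ->
  (exists s3 : R, centered_normal_law P X3 s3) ->
  ('E_P[fun w => (X1 w ^+ (2 * m) * X2 w ^+ 6 * X3 w ^+ 4)%R] >=
     'E_P[fun w => (X1 w ^+ (2 * m))%R] * 'E_P[fun w => (X2 w ^+ 6)%R]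
       * 'E_P[fun w => (X3 w ^+ 4)%R])%E /\
  ('E_P[fun w => (X1 w ^+ (2 * m) * X2 w ^+ 6 * X3 w ^+ 4)%R] =
     'E_P[fun w => (X1 w ^+ (2 * m))%R] * 'E_P[fun w => (X2 w ^+ 6)%R]
       * 'E_P[fun w => (X3 w ^+ 4)%R]
   <-> independent3 P X1 X2 X3)%E.
Proof.
(* From here on [m] is the original [m] minus one, the parameter [n] of the moment form. *)
case: m => // m _ GX [s1 N1] [s2 N2] [s3 N3].
have c11 := integral_sqr_gt0 N1; have c22 := integral_sqr_gt0 N2.
have c33 := integral_sqr_gt0 N3.
have [mX1 mX2 mX3] := gaussian_all_moments GX.
have EE (f : T -> R) : all_moments P f -> ('E_P[f] = (Rintegral P setT f)%:E)%E.
  move=> mf; rewrite unlock /Rintegral fineK//; apply: integrable_fin_num => //.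
  exact: all_moments_integrable.
have mX1n := all_momentsX (2 * m.+1) mX1.
have mX2n := all_momentsX 6 mX2; have mX3n := all_momentsX 4 mX3.
have mX123 := all_momentsM (all_momentsM mX1n mX2n) mX3n.
rewrite (EE _ mX123) (EE _ mX1n) (EE _ mX2n) (EE _ mX3n).
rewrite -!EFinM lee_fin.
have [x [u [y [v [w [-> E22 E33 corr]]]]]] := gaussian_joint_moment GX m c11.
have [E1 _ _] := gaussian_even_moments GX m.+1.
have [_ E2 _] := gaussian_even_moments GX 3.
have [_ _ E3] := gaussian_even_moments GX 2.
have [[_ _ k4 k6 _] _] := std_moment_values R.
rewrite -mul2n in E1; rewrite E1 [X in _ * X * _]E2 [X in _ * X]E3 k4 k6 E22 E33.
have xu0 : 0 < x ^+ 2 + u ^+ 2 by rewrite -E22.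
have yvw0 : 0 < y ^+ 2 + v ^+ 2 + w ^+ 2 by rewrite -E33.
have K0 : 0 < std_moment R (2 * m.+1) * (\int[P]_w (X1 w * X1 w)) ^+ m.+1.
  by rewrite mulr_gt0 ?exprn_gt0// mul2n std_moment_gt0.
set K := (_ * _ ^+ m.+1) in K0 *.
have -> : K * (15 * (x ^+ 2 + u ^+ 2) ^+ 3) * (3 * (y ^+ 2 + v ^+ 2 + w ^+ 2) ^+ 2) =
  K * (45 * (x ^+ 2 + u ^+ 2) ^+ 3 * (y ^+ 2 + v ^+ 2 + w ^+ 2) ^+ 2) by ring.
have ge := moment_form_ge y v w (ler0n R m) xu0.
split.
  rewrite ler_pM2l//; apply: le_trans ge; rewrite -[leRHS]addrA lerDl.
  have e4 (t : R) : 0 <= t ^+ 4 by rewrite (exprM _ 2 2) sqr_ge0.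
  apply: addr_ge0; first by rewrite mulr_ge0 ?sqr_ge0// exprn_ge0// ltW.
  by apply: mulr_ge0; [apply: mulr_ge0; rewrite ?sqr_ge0// mulr_ge0|rewrite addr_ge0].
split=> [[/(mulfI (lt0r_neq0 K0)) Eq]|ind].
  have [c12 c13 c23] := corr.1 (moment_form_eq (ler0n R m) xu0 yvw0 Eq).
  (* After [X1] is split off, [X2] and [X3] are separated by the same lemma for the permuted vector,
     with the whole line as the set for [X1]. *)
  have perm : centered_gaussian_vector3 P X2 X3 X1.
    move=> a b c; have := GX c a b; congr centered_gaussian; apply/funext => t; ring.
  move=> A1 A2 A3 mA1 mA2 mA3.
  rewrite (uncorrelated_independent GX)// -muleA; congr *%E.
  have c21 : \int[P]_w (X2 w * X1 w) = 0.
    by rewrite -[RHS]c12; apply: eq_Rintegral => t _; rewrite mulrC.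
  have := uncorrelated_independent perm c23 c21 mA2 mA3 measurableT.
  by rewrite !preimage_setT !setIT.
have [z1 z2 z3] := gaussian_integral0 GX.
have iM (X Y : T -> R) : all_moments P X -> all_moments P Y ->
    P.-integrable setT (EFin \o (fun t => X t * Y t)).
  by move=> mX mY; apply: all_moments_integrable; exact: all_momentsM.
(* Independence makes each covariance vanish, taking the whole line for the third variable; the
   moment form then reduces to [3 w^4 * 15 u^6]. *)
have [x0 y0 v0] : [/\ x = 0, y = 0 & v = 0].
  apply: corr.2; split; apply: independent_integralM => //;
    try exact: all_moments_integrable; try exact: iM; move=> A B mA mB.
  - by have := ind A B setT mA mB measurableT;
    rewrite preimage_setT setIT probability_setT mule1.
  - by have := ind A setT B mA measurableT mB;
    rewrite preimage_setT setIT probability_setT mule1.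
  - by have := ind setT A B measurableT mA mB;
    rewrite preimage_setT setTI probability_setT mul1e.
congr (K * _)%:E; rewrite x0 y0 v0 /moment_form /moment64 /moment62 /moment60 /coef64_4
  /coef64_3 /coef64_2 /coef64_1 /coef64_0 /coef62_2 /coef62_1 /coef62_0.
by rewrite /=; ring.
Qed.
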